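(* Let $k$ be a field, let $A$, $B$ be symmetric $k$-algebras with chosen symmetrising forms, and let $M$ be an $A$-$B$-bimodule which is finitely generated projective as a left $A$-module and as a right $B$-module. Let $V$, $W$ be finitely generated $B$-modules. For any integer $n$ the diagram of $k$-vector spaces $$\begin{array}{ccccc} \widehat{\mathrm{Ext}}^{n-1}_B(V,W) & \xrightarrow{M\otimes_B-} & \widehat{\mathrm{Ext}}^{n-1}_A(M\otimes_BV,M\otimes_BW) & \xrightarrow{\mathrm{tr}_{M^\vee}(V,W)} & \widehat{\mathrm{Ext}}^{n-1}_B(V,W)\\ \downarrow & & \downarrow & & \downarrow\\ \widehat{\mathrm{Ext}}^{-n}_B(W,V)^\vee & \xrightarrow{(\mathrm{tr}_{M^\vee}(W,V))^\vee} & \widehat{\mathrm{Ext}}^{-n}_A(M\otimes_BW,M\otimes_BV)^\vee & \xrightarrow{(M\otimes_B-)^\vee} & \widehat{\mathrm{Ext}}^{-n}_B(W,V)^\vee \end{array}$$ is commutative, where the vertical maps are the Tate duality isomorphisms.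
   Context: Conventions. For a $k$-vector space $V$, $V^\vee=\mathrm{Hom}_k(V,k)$, and $f^\vee$ is the $k$-dual of a linear map $f$. Modules are unitary left modules; right $B$-modules are modules over the opposite algebra $B^0$; on bimodules the left and right actions of $k$ coincide. A finite-dimensional $k$-algebra $A$ is symmetric if $A\cong A^\vee$ as $A$-$A$-bimodules; a symmetrising form is the image $s\in A^\vee$ of $1_A$ under such an isomorphism (which then sends $a$ to $a\cdot s$, $(a\cdot s)(a')=s(aa')$). Fix symmetrising forms $s$ of $A$ and $t$ of $B$. $M^\vee$ is a $B$-$A$-bimodule via $(b\cdot\mu\cdot a)(m)=\mu(amb)$. Stable category. Let $E$ be a symmetric $k$-algebra and $U,V$ finitely generated $E$-modules. $\mathrm{Hom}_E^{pr}(U,V)$ is the space of homomorphisms factoring through a projective $E$-module, and $\underline{\mathrm{Hom}}_E(U,V)=\mathrm{Hom}_E(U,V)/\mathrm{Hom}_E^{pr}(U,V)$; these are the morphism spaces of the stable category $\underline{\mathrm{mod}}(E)$. Choose a surjection $\pi_U:P_U\to U$ with $P_U$ finitely generated projective and an injection $\iota_U:U\to I_U$ with $I_U$ finitely generated injective; $\Omega(U)=\ker(\pi_U)$, $\Sigma(U)=\mathrm{coker}(\iota_U)$. These induce mutually inverse self-equivalences of $\underline{\mathrm{mod}}(E)$, independent of choices up to unique isomorphism. For $n\in\mathbb Z$, $\widehat{\mathrm{Ext}}^n_E(U,V)=\underline{\mathrm{Hom}}_E(U,\Sigma^n(V))$. Tate duality. Let $E$ have symmetrising form $r$. For $P$ a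 finitely generated projective $E$-module, $\alpha\in\mathrm{Hom}_E(P,E)$ and $v\in V$, let $\lambda_{\alpha,v}\in\mathrm{Hom}_E(P,V)$ be $x\mapsto\alpha(x)v$; these maps span $\mathrm{Hom}_E(P,V)$. There is an isomorphism $\mathrm{Hom}_E(V,P)\cong\mathrm{Hom}_E(P,V)^\vee$ sending $\beta$ to the unique $\hat\beta$ with $\hat\beta(\lambda_{\alpha,v})=r(\alpha(\beta(v)))$. The Tate duality isomorphism $T:\underline{\mathrm{Hom}}_E(V,\Omega(U))\cong\underline{\mathrm{Hom}}_E(U,V)^\vee$ sends the class of $f:V\to\Omega(U)$ to the functional sending the class of $g:U\to V$ to $\widehat{(i\circ f)}(g\circ\pi_U)$, where $i:\Omega(U)\to P_U$ is the inclusion. For $n\in\mathbb Z$ the Tate duality isomorphism $\widehat{\mathrm{Ext}}^{n-1}_E(V,U)\cong\widehat{\mathrm{Ext}}^{-n}_E(U,V)^\vee$ is the composition, with $\Sigma^{n-1}(U)=\Omega\Sigma^n(U)$, $$\underline{\mathrm{Hom}}_E(V,\Sigma^{n-1}(U))\xrightarrow{T}\underline{\mathrm{Hom}}_E(\Sigma^n(U),V)^\vee\cong\underline{\mathrm{Hom}}_E(U,\Sigma^{-n}(V))^\vee,$$ the second isomorphism being induced by the equivalence $\Sigma^n$. Transfer. Choose finitely many $\alpha_i\in\mathrm{Hom}_A(M,A)$, $m_i\in M$ with $\sum_i\alpha_i(m')m_i=m'$ for all $m'\in M$. Every element of $M^\vee$ is uniquely of the form $t\circ\beta$ with $\beta\in\mathrm{Hom}_{B^0}(M,B)$.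 Define bimodule homomorphisms $\epsilon_M:B\to M^\vee\otimes_AM$, $1_B\mapsto\sum_i(s\circ\alpha_i)\otimes m_i$; $\eta_{M^\vee}:M^\vee\otimes_AM\to B$, $(t\circ\beta)\otimes m\mapsto\beta(m)$. Identify $\Sigma^n(M\otimes_BW)=M\otimes_B\Sigma^n(W)$ through the canonical isomorphism in $\underline{\mathrm{mod}}(A)$ (the exact functor $M\otimes_B-$ preserves projectives). The map $M\otimes_B-$ sends the class of $\zeta:V\to\Sigma^n(W)$ to that of $\mathrm{Id}_M\otimes\zeta$. The transfer map $\mathrm{tr}_{M^\vee}(V,W):\widehat{\mathrm{Ext}}^n_A(M\otimes_BV,M\otimes_BW)\to\widehat{\mathrm{Ext}}^n_B(V,W)$ sends the class of $\eta:M\otimes_BV\to M\otimes_B\Sigma^n(W)$ to the class of $$V\xrightarrow{\epsilon_M\otimes\mathrm{Id}_V}M^\vee\otimes_AM\otimes_BV\xrightarrow{\mathrm{Id}_{M^\vee}\otimes\eta}M^\vee\otimes_AM\otimes_B\Sigma^n(W)\xrightarrow{\eta_{M^\vee}\otimes\mathrm{Id}}\Sigma^n(W).$$ *)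

(* Defs.v *)
From HB Require Import structures.
From mathcomp Require Import all_boot all_algebra all_field.
From mathcomp Require Import boolp classical_sets.

Set Implicit Arguments.
Unset Strict Implicit.
Unset Printing Implicit Defensive.

Import GRing.Theory.
Local Open Scope ring_scope.

Section LinearAlgebra.
Variable k : fieldType.
Implicit Types (U V W : vectType k).

Lemma linfunE U V (f : U -> V) : linear f -> linfun f =1 f.
Proof.
move=> lf x; pose fL := GRing.isLinear.Build _ _ _ _ _ lf.
pose fl : {linear U -> V} := HB.pack f fL.
exact: (lfunE fl).
Qed.

Definition vdual V : vectType k := 'Hom(V, k^o).

Definition vdual_map U V (f : 'Hom(U, V)) : 'Hom(vdual V, vdual U) :=
  linfun (fun mu : vdual V => (mu \o f)%VF).

(* Linear span of an arbitrary predicate: a finite family in [P] whose span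
   contains [P] exists because [V] is finite-dimensional. *)
Definition vspan V (P : V -> Prop) : {vspace V} :=
  <<xget [::] (fun X : seq V =>
      (forall x, x \in X -> P x) /\ (forall v, P v -> v \in <<X>>%VS))>>%VS.

Lemma vspan_ex V (P : V -> Prop) :
  exists X : seq V,
    (forall x, x \in X -> P x) /\ (forall v, P v -> v \in <<X>>%VS).
Proof.
pose Q n := `[< exists X : seq V, (forall x, x \in X -> P x) /\ \dim <<X>> = n >].
have exQ : exists n, Q n.
  by exists (\dim <<([::] : seq V)>>%VS); apply/asboolP; exists [::].
have leQ n : Q n -> (n <= \dim {:V})%N.
  by move=> /asboolP[X [_ <-]]; rewrite dimvS ?subvf.
case: (ex_maxnP exQ leQ) => n /asboolP[X [PX dX]] nmax.
exists X; split=> // v Pv.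
have /nmax le : Q (\dim <<v :: X>>%VS).
  apply/asboolP; exists (v :: X); split=> // x.
  by rewrite inE => /orP[/eqP-> //|/PX].
have sub : (<<X>> <= <<v :: X>>)%VS by rewrite span_cons addvSr.
have /eqP -> : (<<X>> == <<v :: X>>)%VS by rewrite eqEdim sub dX.
by rewrite memv_span // mem_head.
Qed.

Lemma mem_vspan V (P : V -> Prop) v : P v -> v \in vspan P.
Proof. by move: v; case: (xgetPex [::] (vspan_ex P)). Qed.

Lemma vspan_ind V (P Q : V -> Prop) :
    Q 0 -> (forall a u v, Q u -> Q v -> Q (a *: u + v)) ->
    (forall v, P v -> Q v) ->
  forall v, v \in vspan P -> Q v.
Proof.
move=> Q0 QD PQ v; case: (xgetPex [::] (vspan_ex P)); rewrite /vspan.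
move: (xget _ _) => X PX _ Xv; rewrite (@coord_span _ _ _ (in_tuple X) v Xv).
apply: big_ind => // [x y Qx Qy|i _]; first by rewrite -[x]scale1r; apply: QD.
by rewrite -[_ *: _]addr0; apply: QD => //; apply: PQ; apply: PX; rewrite mem_nth.
Qed.

Lemma vspanP V (P : V -> Prop) v :
    P 0 -> (forall a u v, P u -> P v -> P (a *: u + v)) ->
  v \in vspan P <-> P v.
Proof. by move=> P0 PD; split; [apply: vspan_ind|apply: mem_vspan]. Qed.

(* The quotient space [V / K], realised on a complement of [K]. *)
Definition vquot V (K : {vspace V}) : vectType k := subvs_of (K^C)%VS.

Definition vpi V (K : {vspace V}) : 'Hom(V, vquot K) :=
  (linfun (vsproj (K^C)%VS) \o daddv_pi (K^C)%VS K)%VF.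

Definition vrep V (K : {vspace V}) : 'Hom(vquot K, V) := linfun vsval.

Definition vlift V W (K : {vspace V}) (f : 'Hom(V, W)) : 'Hom(vquot K, W) :=
  (f \o vrep K)%VF.

Lemma vrepK V (K : {vspace V}) : cancel (vrep K) (vpi K).
Proof.
move=> q; rewrite /vpi /vrep comp_lfunE !lfunE /=.
by rewrite daddv_pi_id ?vsvalK // ?subvsP // capvC capv_compl.
Qed.

Lemma lker_vpi V (K : {vspace V}) : lker (vpi K) = K.
Proof.
have KC0 : (K^C :&: K = 0)%VS by rewrite capvC capv_compl.
have KC1 v : v \in (K^C + K)%VS by rewrite addvC addv_complf memvf.
have piC v : daddv_pi (K^C)%VS K v \in (K^C)%VS by apply: memv_pi.
apply/vspaceP=> v; rewrite memv_ker /vpi comp_lfunE [X in X == _]lfunE.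
apply/eqP/idP => [v0|Kv].
  rewrite -(daddv_pi_add KC0 (KC1 v)).
  by rewrite -(vsprojK (piC v)) v0 linear0 add0r memv_pi.
have := daddv_pi_add KC0 (KC1 v).
rewrite [X in _ + X](daddv_pi_id _ Kv); last by rewrite capv_compl.
by move/eqP; rewrite -subr_eq0 addrK => /eqP->; rewrite linear0.
Qed.

Lemma vpi_eq V (K : {vspace V}) u v : (vpi K u == vpi K v) = (u - v \in K).
Proof. by rewrite -subr_eq0 -raddfB -memv_ker lker_vpi. Qed.

Lemma vliftE V W (K : {vspace V}) (f : 'Hom(V, W)) v :
  (K <= lker f)%VS -> vlift K f (vpi K v) = f v.
Proof.
move=> /subvP sKf; rewrite /vlift comp_lfunE; apply/eqP.
by rewrite -subr_eq0 -raddfB -memv_ker sKf // -vpi_eq vrepK.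
Qed.

End LinearAlgebra.

Section Converse.
Variables (k : fieldType) (B : falgType k).

HB.instance Definition _ := Vector.copy (B^c) B.

(* Naming the product of [B^c] keeps unification from unfolding [B^c] to [B]. *)
Let cmul (u v : B^c) : B^c := @GRing.mul (B^c : nzRingType) u v.

Fact converse_scalerAl (a : k) (u v : B^c) :
  a *: cmul u v = cmul (a *: u) v.
Proof. exact: (@scalerAr k B a v u). Qed.

Fact converse_scalerAr (a : k) (u v : B^c) :
  a *: cmul u v = cmul u (a *: v).
Proof. exact: (@scalerAl k B a v u). Qed.

HB.instance Definition _ :=
  GRing.LSemiModule_isLSemiAlgebra.Build k (B^c) converse_scalerAl.
HB.instance Definition _ :=
  GRing.LSemiAlgebra_isSemiAlgebra.Build k (B^c) converse_scalerAr.

End Converse.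

Section Modules.
Variable k : fieldType.

Record is_action (E : falgType k) (V : vectType k) (act : E -> V -> V) :
    Prop := IsAction {
  act_linear : forall a, linear (act a);
  act_linearl : forall v, linear (act^~ v);
  act1 : forall v, act 1 v = v;
  actM : forall a b v, act (a * b) v = act a (act b v) }.

(* Finitely generated modules over the finite-dimensional algebra [E] are the
   finite-dimensional ones; right [B]-modules are [lmod B^c].  Linearity of the
   action in [E] makes the scalars of [k] act through [k -> E], so that on a
   bimodule the left and right actions of [k] coincide. *)
Record lmod (E : falgType k) : Type := Lmod {
  lsort :> vectType k;
  lact : E -> lsort -> lsort;
  lactP : is_action lact }.

Record bimod (A B : falgType k) : Type := Bimod {
  bsort :> vectType k;
  bl : A -> bsort -> bsort;
  br : B -> bsort -> bsort;
  blP : is_action bl;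
  brP : @is_action B^c bsort br;
  blr : forall a b m, bl a (br b m) = br b (bl a m) }.

Definition leftm A B (M : bimod A B) : lmod A := Lmod (blP M).
Definition rightm A B (M : bimod A B) : lmod B^c := Lmod (brP M).

Definition is_hom (E : falgType k) (U V : lmod E) (f : U -> V) : Prop :=
  forall a u, f (lact a u) = lact a (f u).

Definition is_bihom (A B : falgType k) (M N : bimod A B) (f : M -> N) : Prop :=
  @is_hom A (leftm M) (leftm N) f /\ @is_hom B^c (rightm M) (rightm N) f.

Definition projective (E : falgType k) (P : lmod E) : Prop :=
  forall (X Y : lmod E) (g : 'Hom(X, Y)) (f : 'Hom(P, Y)),
    is_hom g -> is_hom f -> limg g = fullv ->
  exists2 h : 'Hom(P, X), is_hom h & (g \o h)%VF = f.

Definition injective_mod (E : falgType k) (I : lmod E) : Prop :=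
  forall (X Y : lmod E) (g : 'Hom(X, Y)) (f : 'Hom(X, I)),
    is_hom g -> is_hom f -> lker g = 0%VS ->
  exists2 h : 'Hom(Y, I), is_hom h & (h \o g)%VF = f.

Section Regular.
Variable A : falgType k.

Fact regl_subproof : @is_action A A (fun a x => a * x).
Proof.
split=> [a c u v|v c a b|v|a b v]; last 1 first.
- by rewrite mulrA.
- by rewrite mulrDr scalerAr.
- by rewrite mulrDl scalerAl.
by rewrite mul1r.
Qed.

Fact regr_subproof : @is_action A^c A (fun a x => x * a).
Proof.
split=> [a c u v|v c a b|v|a b v].
- by rewrite mulrDl scalerAl.
- by rewrite [LHS]mulrDr scalerAr.
- exact: (@mulr1 A).
exact: (@mulrA A).
Qed.

Fact reg_subproof (a b x : A) : a * (x * b) = a * x * b.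
Proof. exact: mulrA. Qed.

Definition regbim : bimod A A := Bimod regl_subproof regr_subproof reg_subproof.
Definition regmod : lmod A := leftm regbim.

End Regular.

Section Dual.
Variables (A B : falgType k) (M : bimod A B).

Definition dual_l (b : B) (mu : vdual M) : vdual M := linfun (fun m => mu (br b m)).
Definition dual_r (a : A) (mu : vdual M) : vdual M := linfun (fun m => mu (bl a m)).

Lemma dual_lE b mu m : dual_l b mu m = mu (br b m).
Proof.
by rewrite linfunE // => c u v; rewrite (act_linear (brP M)) linearP.
Qed.

Lemma dual_rE a mu m : dual_r a mu m = mu (bl a m).
Proof.
by rewrite linfunE // => c u v; rewrite (act_linear (blP M)) linearP.
Qed.

Fact dual_l_subproof : is_action dual_l.
Proof.
split=> [b c u v|mu c a b|mu|a b mu]; apply/lfunP=> m.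
- by rewrite !(dual_lE, add_lfunE, scale_lfunE).
- rewrite !(dual_lE, add_lfunE, scale_lfunE).
  by rewrite (act_linearl (brP M)) linearP.
- by rewrite dual_lE (act1 (brP M)).
by rewrite !dual_lE; congr (mu _); apply: (actM (brP M)).
Qed.

Fact dual_r_subproof : @is_action A^c (vdual M) dual_r.
Proof.
split=> [b c u v|mu c a b|mu|a b mu]; apply/lfunP=> m.
- by rewrite !(dual_rE, add_lfunE, scale_lfunE).
- rewrite !(dual_rE, add_lfunE, scale_lfunE).
  by rewrite (act_linearl (blP M)) linearP.
- by rewrite dual_rE (act1 (blP M)).
by rewrite !dual_rE; congr (mu _); apply: (actM (blP M)).
Qed.

Fact dual_subproof b a mu : dual_l b (dual_r a mu) = dual_r a (dual_l b mu).
Proof. by apply/lfunP=> m; rewrite !(dual_lE, dual_rE) blr. Qed.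

(* [M^\vee], with [(b . mu . a) m = mu (a m b)]. *)
Definition dualbim : bimod B A :=
  Bimod dual_l_subproof dual_r_subproof dual_subproof.

End Dual.

(* [s] is the image of [1] under some bimodule isomorphism from [A] onto
   [A^\vee]; in particular [A] is symmetric. *)
Definition symmetrising (A : falgType k) (s : vdual A) : Prop :=
  exists Phi : 'Hom(A, vdual A),
    [/\ @is_bihom A A (regbim A) (dualbim (regbim A)) Phi,
        bijective Phi & Phi 1 = s].

End Modules.

Section Tensor.
Variable k : fieldType.

Section VectorSpaces.
Variables X Y : vectType k.

Definition ktens : vectType k := 'M[k]_(\dim {:X}, \dim {:Y}).

Definition kpure (x : X) (y : Y) : ktens :=
  \matrix_(i, j) (coord (vbasis {:X}) i x * coord (vbasis {:Y}) j y).

Definition klift (Z : vectType k) (f : X -> Y -> Z) : 'Hom(ktens, Z) :=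
  linfun (fun T : ktens =>
    \sum_i \sum_j T i j *: f (vbasis {:X})`_i (vbasis {:Y})`_j).

Definition bilin (Z : vectType k) (f : X -> Y -> Z) : Prop :=
  (forall x, linear (f x)) /\ (forall y, linear (f^~ y)).

End VectorSpaces.

Lemma kpure_bilin (X Y : vectType k) : bilin (@kpure X Y).
Proof.
by split=> [x c u v|y c u v]; apply/matrixP=> i j;
  rewrite !mxE linearP /= ?mulrDr ?mulrDl ?mulrA // mulrAC mulrC mulrA.
Qed.

Lemma kpure_sum (X Y : vectType k) (T : ktens X Y) :
  T = \sum_i \sum_j T i j *: kpure (vbasis {:X})`_i (vbasis {:Y})`_j.
Proof.
have fX := basis_free (vbasisP {:X}); have fY := basis_free (vbasisP {:Y}).
rewrite [LHS]matrix_sum_delta; apply: eq_bigr => i _; apply: eq_bigr => j _.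
congr (_ *: _); apply/matrixP=> i' j'.
by rewrite !mxE !coord_free // -natrM mulnb eq_sym [j' == j]eq_sym.
Qed.

Lemma klift_linear (X Y Z : vectType k) (f : X -> Y -> Z) :
  linear (fun T : ktens X Y =>
    \sum_i \sum_j T i j *: f (vbasis {:X})`_i (vbasis {:Y})`_j).
Proof.
move=> c S T; rewrite scaler_sumr -big_split; apply: eq_bigr => i _.
rewrite scaler_sumr -big_split; apply: eq_bigr => j _.
by rewrite !mxE scalerDl scalerA.
Qed.

Lemma kliftE (X Y Z : vectType k) (f : X -> Y -> Z) x y :
  bilin f -> klift f (kpure x y) = f x y.
Proof.
move=> [fr fl]; rewrite linfunE; last exact: klift_linear.
rewrite [x in RHS](coord_vbasis (memvf x)).
rewrite [y in RHS](coord_vbasis (memvf y)).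
pose f1 y := linfun (f^~ y); pose f2 x := linfun (f x).
have f1E y' x' : f x' y' = f1 y' x' by rewrite linfunE.
have f2E y' x' : f x' y' = f2 x' y' by rewrite linfunE.
rewrite f1E linear_sum; apply: eq_bigr => i _; rewrite linearZ /= -f1E.
rewrite f2E linear_sum scaler_sumr; apply: eq_bigr => j _.
by rewrite linearZ /= -f2E scalerA mxE.
Qed.

Variable B : falgType k.
Implicit Types (X : lmod B^c) (Y : lmod B) (Z : vectType k).

Definition ract X (x : X) (b : B) : X := @lact k B^c X b x.

Definition balanced X Y Z (f : X -> Y -> Z) : Prop :=
  forall x b y, f (ract x b) y = f x (lact b y).

Definition tens_rel X Y : {vspace ktens X Y} :=
  vspan (fun z => exists x b y, z = kpure (ract x b) y - kpure x (lact b y)).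

Definition tens X Y : vectType k := vquot (tens_rel X Y).

Definition tpure X Y (x : X) (y : Y) : tens X Y :=
  vpi (tens_rel X Y) (kpure x y).

Definition tlift X Y Z (f : X -> Y -> Z) : 'Hom(tens X Y, Z) :=
  vlift (tens_rel X Y) (klift f).

Lemma tpure_bilin X Y : bilin (@tpure X Y).
Proof.
have [Hr Hl] := @kpure_bilin X Y.
by split=> [x|y] c u v; rewrite /tpure ?Hr ?Hl linearP.
Qed.

Lemma tpure_balanced X Y : balanced (@tpure X Y).
Proof.
move=> x b y; apply/eqP; rewrite vpi_eq; apply: mem_vspan.
by exists x, b, y.
Qed.

Lemma tliftE X Y Z (f : X -> Y -> Z) x y :
  bilin f -> balanced f -> tlift f (tpure x y) = f x y.
Proof.
move=> bf balf; rewrite /tlift vliftE ?kliftE //.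
apply/subvP; apply: (@vspan_ind _ _ _ (fun z => z \in lker (klift f))).
- exact: mem0v.
- by move=> c u v Ku Kv; rewrite memvD ?memvZ.
by move=> z [x' [b [y' ->]]]; rewrite memv_ker linearB /= !kliftE // balf subrr.
Qed.

Lemma tens_ext X Y Z (f g : 'Hom(tens X Y, Z)) :
  (forall x y, f (tpure x y) = g (tpure x y)) -> f = g.
Proof.
move=> fg; apply/lfunP=> z; rewrite -(vrepK z); move: (vrep _ z) => T.
rewrite (kpure_sum T) !linear_sum; apply: eq_bigr => i _.
rewrite !linear_sum; apply: eq_bigr => j _.
by rewrite !linearZ; congr (_ *: _); apply: fg.
Qed.

Definition tens_map X X' Y Y' (f : X -> X') (g : Y -> Y') :
    'Hom(tens X Y, tens X' Y') :=
  tlift (fun x y => tpure (f x) (g y)).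

Lemma tens_mapE X X' Y Y' (f : X -> X') (g : Y -> Y') x y :
    linear f -> linear g -> is_hom f -> is_hom g ->
  tens_map f g (tpure x y) = tpure (f x) (g y).
Proof.
move=> lf lg hf hg; have [Hr Hl] := @tpure_bilin X' Y'; rewrite tliftE //.
  by split=> [z|z] c u v; rewrite ?lf ?lg ?Hr ?Hl.
by move=> z b t; rewrite hg -tpure_balanced /ract -hf.
Qed.

End Tensor.

Section TensorModules.
Variables (k : fieldType) (A B C : falgType k).

Lemma lact_linear (V : lmod B) a : linear (@lact k B V a).
Proof. exact: act_linear (lactP V) a. Qed.

Lemma lact0 (V : lmod B) a : lact a (0 : V) = 0.
Proof. by rewrite -(linfunE (lact_linear a)) linear0. Qed.

Lemma id_hom (V : lmod B) : is_hom (fun v : V => v). Proof. by []. Qed.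

Lemma id_linear (V : vectType k) : linear (fun v : V => v). Proof. by []. Qed.

Section Left.
Variables (M : bimod A B) (V : lmod B).

Definition tens_l (a : A) : 'Hom(tens (rightm M) V, tens (rightm M) V) :=
  @tens_map k B (rightm M) (rightm M) V V (bl a) (fun v => v).

Lemma tens_lE a m v : tens_l a (tpure m v) = @tpure k B (rightm M) V (bl a m) v.
Proof.
apply: tens_mapE; [exact: act_linear (blP M) a|exact: id_linear| |exact: id_hom].
by move=> b m'; apply: blr.
Qed.

Fact tens_l_subproof : is_action (fun a z => tens_l a z).
Proof.
have [Hr Hl] := @tpure_bilin _ _ (rightm M) V.
split=> [a c u v|z c a b|z|a b z]; first exact: linearP.
- suff ->: tens_l (c *: a + b) = c *: tens_l a + tens_l b.
    by rewrite add_lfunE scale_lfunE.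
  apply: tens_ext => m v; rewrite add_lfunE scale_lfunE !tens_lE.
  by rewrite (act_linearl (blP M)) Hl.
- suff ->: tens_l 1 = \1%VF by rewrite id_lfunE.
  by apply: tens_ext => m v; rewrite tens_lE id_lfunE (act1 (blP M)).
suff ->: tens_l (a * b) = (tens_l a \o tens_l b)%VF by rewrite comp_lfunE.
by apply: tens_ext => m v; rewrite comp_lfunE !tens_lE (actM (blP M)).
Qed.

Definition tensm : lmod A := Lmod tens_l_subproof.

End Left.

Section Right.
Variables (X : lmod B^c) (N : bimod B C).

Definition tens_r (c : C) : 'Hom(tens X (leftm N), tens X (leftm N)) :=
  @tens_map k B X X (leftm N) (leftm N) (fun x => x) (br c).

Lemma tens_rE c x n : tens_r c (tpure x n) = @tpure k B X (leftm N) x (br c n).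
Proof.
apply: tens_mapE; [exact: id_linear|exact: act_linear (brP N) c|by []|].
by move=> b n'; symmetry; apply: blr.
Qed.

Fact tens_r_subproof : @is_action k C^c _ (fun c z => tens_r c z).
Proof.
have [Hr Hl] := @tpure_bilin _ _ X (leftm N).
split=> [a c u v|z c a b|z|a b z]; first exact: linearP.
- suff ->: tens_r (c *: a + b) = c *: tens_r a + tens_r b.
    by rewrite add_lfunE scale_lfunE.
  apply: tens_ext => x n; rewrite add_lfunE scale_lfunE !tens_rE.
  by rewrite (act_linearl (brP N)) Hr.
- suff ->: tens_r 1 = \1%VF by rewrite id_lfunE.
  by apply: tens_ext => x n; rewrite tens_rE id_lfunE (act1 (brP N)).
suff ->: tens_r (a * b) = (tens_r a \o tens_r b)%VF by rewrite comp_lfunE.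
by apply: tens_ext => x n; rewrite comp_lfunE !tens_rE (actM (brP N)).
Qed.

End Right.

Fact tens_lr_subproof (M : bimod A B) (N : bimod B C) a c z :
  tens_l M (leftm N) a (tens_r (rightm M) N c z) =
  tens_r (rightm M) N c (tens_l M (leftm N) a z).
Proof.
pose L := tens_l M (leftm N) a; pose R := tens_r (rightm M) N c.
suff: (L \o R = R \o L)%VF by move/lfunP/(_ z); rewrite !comp_lfunE.
apply: tens_ext => m n; rewrite [LHS]comp_lfunE [RHS]comp_lfunE.
rewrite [X in L X]tens_rE [X in R X]tens_lE.
by rewrite [LHS]tens_lE [RHS]tens_rE.
Qed.

Definition tensb (M : bimod A B) (N : bimod B C) : bimod A C :=
  Bimod (tens_l_subproof M (leftm N)) (tens_r_subproof (rightm M) N)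
    (@tens_lr_subproof M N).

End TensorModules.

Section Associativity.
Variables (k : fieldType) (A B C : falgType k).

(* The mutually inverse maps [(X \otimes_A M) \otimes_B V <->
   X \otimes_A (M \otimes_B V)]. *)
Definition tens_assoc (X : bimod C A) (M : bimod A B) (V : lmod B) :
    'Hom(tensm (tensb X M) V, tensm X (tensm M V)) :=
  @tlift k B (rightm (tensb X M)) V (tensm X (tensm M V))
    (fun z v => @tlift k A (rightm X) (leftm M) (tensm X (tensm M V))
      (fun x m => @tpure k A (rightm X) (tensm M V) x
                    (@tpure k B (rightm M) V m v)) z).

Definition tens_assocV (X : bimod C A) (M : bimod A B) (V : lmod B) :
    'Hom(tensm X (tensm M V), tensm (tensb X M) V) :=
  @tlift k A (rightm X) (tensm M V) (tensm (tensb X M) V)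
    (fun x z => @tlift k B (rightm M) V (tensm (tensb X M) V)
      (fun m v => @tpure k B (rightm (tensb X M)) V
                    (@tpure k A (rightm X) (leftm M) x m) v) z).

Definition tensm_map (M : bimod A B) (V W : lmod B) (f : V -> W) :
    'Hom(tensm M V, tensm M W) :=
  @tens_map k B (rightm M) (rightm M) V W (fun m => m) f.

End Associativity.

Section StableCategory.
Variables (k : fieldType) (E : falgType k).
Implicit Types (U V W X Y : lmod E).

Definition HomE U V : {vspace 'Hom(U, V)} :=
  vspan (fun f : 'Hom(U, V) => is_hom f).

Lemma mem_HomE U V (f : 'Hom(U, V)) : f \in HomE U V <-> is_hom f.
Proof.
apply: vspanP => [a u|a g h hg hh b u].
  by rewrite !zero_lfunE lact0.
by rewrite !(add_lfunE, scale_lfunE) hg hh lact_linear.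
Qed.

Definition homE U V : vectType k := subvs_of (HomE U V).

(* Only meaningful on [E]-linear [f]; likewise for [scls] below.  Maps on
   stable Hom spaces are computed on the representatives chosen by [srep]. *)
Definition mkhom U V (f : 'Hom(U, V)) : homE U V := vsproj (HomE U V) f.

Definition homE_pr U V : {vspace homE U V} :=
  vspan (fun f : homE U V => exists P : lmod E, projective P /\
    exists (g : 'Hom(U, P)) (h : 'Hom(P, V)),
      [/\ is_hom g, is_hom h & vsval f = (h \o g)%VF]).

Definition sthom U V : vectType k := vquot (homE_pr U V).

Definition scls U V (f : 'Hom(U, V)) : sthom U V := vpi (homE_pr U V) (mkhom f).

Definition srep U V (x : sthom U V) : 'Hom(U, V) := vsval (vrep (homE_pr U V) x).

Lemma srep_hom U V (x : sthom U V) : is_hom (srep x).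
Proof. by apply/mem_HomE; apply: subvsP. Qed.

Lemma srepK U V (x : sthom U V) : scls (srep x) = x.
Proof. by rewrite /scls /mkhom /srep vsvalK vrepK. Qed.

Definition sid U : sthom U U := scls \1%VF.

Definition scomp U V W (y : sthom V W) (x : sthom U V) : sthom U W :=
  scls (srep y \o srep x)%VF.

Definition sinv U V (x : sthom U V) : sthom V U :=
  xget 0 (fun y => scomp y x = sid U /\ scomp x y = sid V).

Definition scast U V (e : U = V) : sthom U V :=
  match e in _ = V' return sthom U V' with erefl => sid U end.

Section Kernel.
Variables (U V : lmod E) (f : 'Hom(U, V)) (hf : is_hom f).

Definition ker_act (a : E) (u : subvs_of (lker f)) : subvs_of (lker f) :=
  vsproj (lker f) (lact a (vsval u)).

Lemma ker_actE a u : vsval (ker_act a u) = lact a (vsval u).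
Proof.
apply: vsprojK; rewrite memv_ker hf.
by move: (subvsP u); rewrite memv_ker => /eqP->; rewrite lact0.
Qed.

Fact ker_subproof : is_action ker_act.
Proof.
split=> [a c u v|v c a b|v|a b v]; apply: val_inj;
  rewrite /= ?linearP /= !ker_actE.
- by rewrite linearP lact_linear.
- exact: act_linearl (lactP U) _ _ _ _.
- exact: act1 (lactP U) _.
exact: actM (lactP U) _ _ _.
Qed.

Definition kermod : lmod E := Lmod ker_subproof.

End Kernel.

Section Cokernel.
Variables (U V : lmod E) (f : 'Hom(U, V)) (hf : is_hom f).

Definition coker_act (a : E) (q : vquot (limg f)) : vquot (limg f) :=
  vpi (limg f) (lact a (vrep (limg f) q)).

Lemma coker_actE a v : coker_act a (vpi (limg f) v) = vpi (limg f) (lact a v).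
Proof.
pose La : 'Hom(V, V) := linfun (@lact k E V a).
have LaE : La =1 lact a by apply: linfunE; apply: lact_linear.
apply/eqP; rewrite vpi_eq -!LaE -linearB /= LaE.
have: vrep (limg f) (vpi (limg f) v) - v \in limg f by rewrite -vpi_eq vrepK.
by case/memv_imgP=> u _ ->; rewrite -hf memv_img ?memvf.
Qed.

Fact coker_subproof : is_action coker_act.
Proof.
split=> [a c q r|q c a b|q|a b q].
- rewrite -[q]vrepK -[r]vrepK -linearP !coker_actE.
  by rewrite lact_linear linearP.
- by rewrite -[q]vrepK !coker_actE (act_linearl (lactP V)) linearP.
- by rewrite -[q]vrepK coker_actE (act1 (lactP V)).
by rewrite -[q]vrepK !coker_actE (actM (lactP V)).
Qed.

Definition cokermod : lmod E := Lmod coker_subproof.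

End Cokernel.

Record proj_onto U : Type := ProjOnto {
  po_mod : lmod E;
  po_map : 'Hom(po_mod, U);
  po_projective : projective po_mod;
  po_hom : is_hom po_map;
  po_surj : limg po_map = fullv }.
Arguments po_projective {U} p.
Arguments po_hom {U} p.

Record inj_into U : Type := InjInto {
  ii_mod : lmod E;
  ii_map : 'Hom(U, ii_mod);
  ii_injective : injective_mod ii_mod;
  ii_hom : is_hom ii_map;
  ii_inj : lker ii_map = 0%VS }.
Arguments ii_injective {U} i.
Arguments ii_hom {U} i.

(* A choice of [P_U -> U] and of [U -> I_U] for every module [U]. *)
Record resolution : Type := Resolution {
  res_proj : forall U, proj_onto U;
  res_inj : forall U, inj_into U }.

(* A sequence [X -> Q -> Y], with its outer terms in the type. *)
Record seq3 X Y : Type := Seq3 {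
  smid : lmod E;
  sinc : 'Hom(X, smid);
  spro : 'Hom(smid, Y) }.

Definition seq3_map X Y X' Y' (s : seq3 X Y) (s' : seq3 X' Y')
    (f : 'Hom(X, X')) (g : 'Hom(Y, Y')) : Prop :=
  [/\ is_hom f, is_hom g & exists h : 'Hom(smid s, smid s'),
    [/\ is_hom h, (h \o sinc s = sinc s' \o f)%VF
      & (spro s' \o h = g \o spro s)%VF]].

(* For short exact sequences [s], [s'], a stable map between the right-hand
   terms determines one between the left-hand terms if the middle term of [s]
   is projective, and conversely if the middle term of [s'] is injective. *)
Definition st_left X Y X' Y' (s : seq3 X Y) (s' : seq3 X' Y')
    (y : sthom Y Y') : sthom X X' :=
  xget 0 (fun x => exists f g,
    [/\ seq3_map s s' f g, scls g = y & scls f = x]).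

Definition st_right X Y X' Y' (s : seq3 X Y) (s' : seq3 X' Y')
    (x : sthom X X') : sthom Y Y' :=
  xget 0 (fun y => exists f g,
    [/\ seq3_map s s' f g, scls f = x & scls g = y]).

Section Shift.
Variable R : resolution.

Definition Omega U : lmod E := kermod (po_hom (res_proj R U)).
Definition Sigma U : lmod E := cokermod (ii_hom (res_inj R U)).

Definition omega_inc U : 'Hom(Omega U, po_mod (res_proj R U)) := linfun vsval.

Definition omega_seq U : seq3 (Omega U) U :=
  @Seq3 (Omega U) U _ (omega_inc U) (po_map (res_proj R U)).
Definition sigma_seq U : seq3 U (Sigma U) :=
  @Seq3 U (Sigma U) _ (ii_map (res_inj R U)) (vpi (limg (ii_map (res_inj R U)))).

Definition Omega_map U V : sthom U V -> sthom (Omega U) (Omega V) :=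
  st_left (omega_seq U) (omega_seq V).
Definition Sigma_map U V : sthom U V -> sthom (Sigma U) (Sigma V) :=
  st_right (sigma_seq U) (sigma_seq V).

(* The canonical isomorphisms making [Omega] and [Sigma] mutually inverse. *)
Definition to_OmegaSigma U : sthom U (Omega (Sigma U)) :=
  st_left (sigma_seq U) (omega_seq (Sigma U)) (sid (Sigma U)).
Definition of_OmegaSigma U : sthom (Omega (Sigma U)) U :=
  st_left (omega_seq (Sigma U)) (sigma_seq U) (sid (Sigma U)).
Definition of_SigmaOmega U : sthom (Sigma (Omega U)) U :=
  st_right (sigma_seq (Omega U)) (omega_seq U) (sid (Omega U)).

Definition shift (n : int) U : lmod E :=
  match n with
  | Posz m => iter m Sigma U
  | Negz m => iter m.+1 Omega U
  end.

Definition Ext (n : int) U V : vectType k := sthom U (shift n V).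

Fixpoint Sigma_mapn m U V : sthom U V -> sthom (iter m Sigma U) (iter m Sigma V) :=
  match m with
  | 0%N => fun x => x
  | m'.+1 => fun x => Sigma_map (Sigma_mapn m' x)
  end.

Fixpoint Omega_mapn m U V : sthom U V -> sthom (iter m Omega U) (iter m Omega V) :=
  match m with
  | 0%N => fun x => x
  | m'.+1 => fun x => Omega_map (Omega_mapn m' x)
  end.

Definition shift_map (n : int) U V : sthom U V -> sthom (shift n U) (shift n V) :=
  match n with
  | Posz m => @Sigma_mapn m U V
  | Negz m => @Omega_mapn m.+1 U V
  end.

(* [Sigma^m Omega^m V -> V] and [Omega^m Sigma^m V -> V], cancelling the
   innermost pair first. *)
Fixpoint of_SigmaOmegan m V : sthom (iter m Sigma (iter m Omega V)) V :=
  match m with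
  | 0%N => sid V
  | m'.+1 =>
    scomp (of_SigmaOmega V)
      (scomp (Sigma_map (of_SigmaOmegan m' (Omega V)))
        (scast (congr1 (iter m'.+1 Sigma) (iterSr m' Omega V))))
  end.

Fixpoint of_OmegaSigman m V : sthom (iter m Omega (iter m Sigma V)) V :=
  match m with
  | 0%N => sid V
  | m'.+1 =>
    scomp (of_OmegaSigma V)
      (scomp (Omega_map (of_OmegaSigman m' (Sigma V)))
        (scast (congr1 (iter m'.+1 Omega) (iterSr m' Sigma V))))
  end.

(* [Sigma^n Sigma^(-n) V -> V] *)
Definition shift_cancel (n : int) V : sthom (shift n (shift (- n) V)) V :=
  match n with
  | Posz 0 => sid V
  | Posz m.+1 => of_SigmaOmegan m.+1 V
  | Negz m => of_OmegaSigman m.+1 V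
  end.

Lemma PoszSB1 m : m.+1%:Z - 1 = m.
Proof. by rewrite -addn1 PoszD addrK. Qed.

Lemma NegzB1 m : Negz m - 1 = Negz m.+1.
Proof. by rewrite !NegzE -opprD -PoszD addn1. Qed.

(* The identification [Sigma^(n-1) U = Omega Sigma^n U]. *)
Definition shift_pred (n : int) U : sthom (shift (n - 1) U) (Omega (shift n U)) :=
  match n with
  | Posz 0 => sid (Omega U)
  | Posz m.+1 =>
    scomp (to_OmegaSigma (iter m Sigma U)) (scast (congr1 (shift^~ U) (PoszSB1 m)))
  | Negz m => scast (congr1 (shift^~ U) (NegzB1 m))
  end.

Variable r : vdual E.

Definition lambda (P V : lmod E) (alpha : 'Hom(P, regmod E)) (v : V) : 'Hom(P, V) :=
  linfun (fun x => lact (alpha x : E) v).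

(* The unique functional on [Hom_E(P, V)] with the stated values: for [P]
   projective the maps [lambda alpha v] span [Hom_E(P, V)]. *)
Definition hat (P V : lmod E) (beta : 'Hom(V, P)) : vdual (homE P V) :=
  xget 0 (fun phi : vdual (homE P V) =>
    forall (alpha : 'Hom(P, regmod E)) (v : V), is_hom alpha ->
      phi (mkhom (lambda alpha v)) = r (alpha (beta v))).

Definition tate0 U V : 'Hom(sthom V (Omega U), vdual (sthom U V)) :=
  linfun (fun x => linfun (fun y : sthom U V =>
    hat (omega_inc U \o srep x)%VF
      (mkhom (srep y \o po_map (res_proj R U))%VF)) : vdual (sthom U V)).

Definition tate (n : int) U V :
    'Hom(Ext (n - 1) V U, vdual (Ext (- n) U V)) :=
  (vdual_map (linfun (fun y : Ext (- n) U V =>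
       scomp (shift_cancel n V) (shift_map n y)))
   \o tate0 (shift n U) V
   \o linfun (fun x : Ext (n - 1) V U => scomp (shift_pred n U) x))%VF.

End Shift.
End StableCategory.

Section Transfer.
Variables (k : fieldType) (A B : falgType k).
Variables (RA : resolution A) (RB : resolution B) (M : bimod A B).

Definition tensm_seq (X Y : lmod B) (s : seq3 X Y) :
    seq3 (tensm M X) (tensm M Y) :=
  @Seq3 k A (tensm M X) (tensm M Y) (tensm M (smid s))
    (tensm_map M (sinc s)) (tensm_map M (spro s)).

(* The canonical isomorphism [Sigma^n (M \otimes_B W) -> M \otimes_B Sigma^n W]. *)
Fixpoint tensm_Sigman m (W : lmod B) :
    sthom (iter m (Sigma RA) (tensm M W)) (tensm M (iter m (Sigma RB) W)) :=
  match m with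
  | 0%N => sid (tensm M W)
  | m'.+1 => st_right (sigma_seq RA _)
      (tensm_seq (sigma_seq RB (iter m' (Sigma RB) W))) (tensm_Sigman m' W)
  end.

Fixpoint tensm_Omegan m (W : lmod B) :
    sthom (iter m (Omega RA) (tensm M W)) (tensm M (iter m (Omega RB) W)) :=
  match m with
  | 0%N => sid (tensm M W)
  | m'.+1 => st_left (omega_seq RA _)
      (tensm_seq (omega_seq RB (iter m' (Omega RB) W))) (tensm_Omegan m' W)
  end.

Definition tensm_shift (n : int) (W : lmod B) :
    sthom (shift RA n (tensm M W)) (tensm M (shift RB n W)) :=
  match n with
  | Posz m => tensm_Sigman m W
  | Negz m => tensm_Omegan m.+1 W
  end.

Definition tensm_Ext (n : int) (V W : lmod B) :
    'Hom(Ext RB n V W, Ext RA n (tensm M V) (tensm M W)) :=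
  linfun (fun x : Ext RB n V W =>
    scomp (sinv (tensm_shift n W)) (scls (tensm_map M (srep x)))).

Variables (s : vdual A) (t : vdual B).
Variables (d : nat) (alpha : 'I_d -> 'Hom(M, A)) (m_ : 'I_d -> M).

Definition MdM : bimod B B := tensb (dualbim M) M.

Definition eps_tr : 'Hom(B, MdM) :=
  linfun (fun b => bl b (\sum_i
    @tpure k A (rightm (dualbim M)) (leftm M) (s \o alpha i)%VF (m_ i) : MdM)).

(* The right [B]-linear [beta] with [mu = t \o beta]. *)
Definition beta_of (mu : vdual M) : 'Hom(M, B) :=
  xget 0 (fun beta : 'Hom(M, B) =>
    @is_hom k B^c (rightm M) (rightm (regbim B)) beta /\ (t \o beta)%VF = mu).

Definition eta_tr : 'Hom(MdM, B) :=
  @tlift k A (rightm (dualbim M)) (leftm M) B (fun mu m => beta_of mu m).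

(* [X = B \otimes_B X] *)
Definition to_regtens (X : lmod B) : 'Hom(X, tensm (regbim B) X) :=
  linfun (fun x => @tpure k B (rightm (regbim B)) X (1 : B) x).
Definition of_regtens (X : lmod B) : 'Hom(tensm (regbim B) X, X) :=
  @tlift k B (rightm (regbim B)) X X (fun b x => lact (b : B) x).

Definition tr_rep (V X : lmod B) (eta : 'Hom(tensm M V, tensm M X)) :
    'Hom(V, X) :=
  (of_regtens X
   \o @tens_map k B (rightm MdM) (rightm (regbim B)) X X eta_tr (fun x => x)
   \o tens_assocV (dualbim M) M X
   \o tensm_map (dualbim M) eta
   \o tens_assoc (dualbim M) M V
   \o @tens_map k B (rightm (regbim B)) (rightm MdM) V V eps_tr (fun v => v)
   \o to_regtens V)%VF.

Definition tr (n : int) (V W : lmod B) :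
    'Hom(Ext RA n (tensm M V) (tensm M W), Ext RB n V W) :=
  linfun (fun x : Ext RA n (tensm M V) (tensm M W) =>
    scls (tr_rep (srep (scomp (tensm_shift n W) x)))).

End Transfer.

(* Main.v *)
Require Import Defs.
From HB Require Import structures.
From mathcomp Require Import all_boot all_algebra all_field.
From mathcomp Require Import boolp classical_sets.

(** Tate duality is a trace.  For a projective module [P] over an algebra with
symmetrising form [r], let [ptr r P] be the trace [End(P) -> k] with values read
through [r].  The functional [hat beta] takes [gamma] to the trace of
[beta \o gamma], so if [x : V -> \Omega U] and [y : U -> V] are stable maps and
[\Omega U -> P -> U] is the defining sequence, then the duality pairs [x] and [y]
to the trace on [P] of
[P -> U -> V -> \Omega U -> P] ([tate0E]).  The same formula defines a [pairing]
for every short exact sequence with projective middle term, and cyclicity of the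
trace makes this pairing natural in the sequence ([pairing_natural]).

The theorem rests on one computation, [ptr_tr_rep]: for a projective [B]-module
[P] and an [A]-endomorphism [eta] of [M \otimes_B P],
the trace of the transfer of [eta] equals the trace of [eta].  If
[(alpha i, m i)] and [(g j, p j)] are dual bases of [M] and [P], the elements
[m i \otimes p j] form a dual basis of [M \otimes P] together with the maps
[m \otimes p |-> alpha i (m (g j p))], and both traces expand to the same double
sum because the transfer is [v |-> \sum_i beta_i (eta (m i \otimes v))], where
[beta_i] contracts [M] by the right linear map with [t \o beta_i = s \o alpha i]
([tr_repE]).  Since the transfer is natural, it follows that
transfer and [M \otimes -] are adjoint for the pairings of a sequence and of
the tensored sequence ([pairing_trr], [pairing_trl]).  For a fixed sequence these
two adjunctions are the two squares of the theorem.

The remainder compares the shifts on both sides.  The sequences in question have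
middle terms which are projective and injective, so a stable map between the left
terms determines one between the right terms, and conversely ([stmap]).
Tensoring with [M] is exact, and it preserves this relation, as does the transfer.
Hence the comparison [\Sigma^n (M \otimes W) -> M \otimes \Sigma^n W] commutes
with shifted maps, with the identification of [\Sigma^(n-1)] with
[\Omega \Sigma^n] ([tensm_shift_pred]), with the cancellation of [\Sigma^n]
against [\Sigma^(-n)] ([tensm_shift_cancel]), and with the transfer
([trst_shift]).  The cases of positive and of negative [n] are instances of
the same formal statement about two functors [S] and [O] with a natural
transformation [S O -> 1] ([canceln_compn]). *)

Set Implicit Arguments.
Unset Strict Implicit.
Unset Printing Implicit Defensive.

Import GRing.Theory.
Local Open Scope ring_scope.

(** * Homomorphisms and projective bases *)

Section Homs.
Variables (k : fieldType) (E : falgType k).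
Implicit Types (U V W X Y P Q : lmod E).

Lemma lact_sumr V (a : E) I (r : seq I) (F : I -> V) :
  lact a (\sum_(i <- r) F i) = \sum_(i <- r) lact a (F i).
Proof.
rewrite -(linfunE (lact_linear a)) linear_sum /=.
by apply: eq_bigr => i _; rewrite linfunE //; apply: lact_linear.
Qed.

Lemma lact_suml V (v : V) I (r : seq I) (F : I -> E) :
  lact (\sum_(i <- r) F i) v = \sum_(i <- r) lact (F i) v.
Proof.
rewrite -(linfunE (act_linearl (lactP V) v)) linear_sum /=.
by apply: eq_bigr => i _; rewrite linfunE //; apply: act_linearl (lactP V) v.
Qed.

Lemma lactZl V (v : V) c (a : E) : lact (c *: a) v = c *: lact a v.
Proof.
by rewrite -(linfunE (act_linearl (lactP V) v)) linearZ /= linfunE //;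
  apply: act_linearl (lactP V) v.
Qed.

Lemma lact0l V (v : V) : lact (0 : E) v = 0.
Proof. by rewrite -[0 : E](scale0r 0) lactZl scale0r. Qed.

Lemma lactA V (v : V) (a b : E) : lact (a * b) v = lact a (lact b v).
Proof. exact: (actM (lactP V)). Qed.

Lemma comp_hom U V W (g : 'Hom(V, W)) (f : 'Hom(U, V)) :
  is_hom g -> is_hom f -> is_hom (g \o f)%VF.
Proof. by move=> hg hf a u; rewrite !comp_lfunE hf hg. Qed.

Lemma id_is_hom U : is_hom (\1%VF : 'Hom(U, U)).
Proof. by move=> a u; rewrite !id_lfunE. Qed.

Lemma linear_hom U V c (f g : 'Hom(U, V)) :
  is_hom f -> is_hom g -> is_hom (c *: f + g).
Proof. by move=> /mem_HomE hf /mem_HomE hg; apply/mem_HomE/memvD/hg/memvZ. Qed.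

Lemma sum_hom U V I (r : seq I) (F : I -> 'Hom(U, V)) :
  (forall i, is_hom (F i)) -> is_hom (\sum_(i <- r) F i).
Proof. by move=> hF; apply/mem_HomE/memv_suml => i _; apply/mem_HomE. Qed.

Lemma lambdaE P V (al : 'Hom(P, regmod E)) (v : V) x :
  lambda al v x = lact (al x : E) v.
Proof. by rewrite linfunE // => c u w; rewrite linearP (act_linearl (lactP V)). Qed.

Lemma lambda_hom P V (al : 'Hom(P, regmod E)) (v : V) :
  is_hom al -> is_hom (lambda al v).
Proof. by move=> ha a x; rewrite !lambdaE ha lactA. Qed.

Lemma lambda_compl P V W (al : 'Hom(P, regmod E)) (v : V) (g : 'Hom(V, W)) :
  is_hom g -> (g \o lambda al v)%VF = lambda al (g v).
Proof. by move=> hg; apply/lfunP=> x; rewrite comp_lfunE !lambdaE hg. Qed.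

Lemma lambda_compr U P V (al : 'Hom(P, regmod E)) (v : V) (f : 'Hom(U, P)) :
  (lambda al v \o f)%VF = lambda (al \o f)%VF v.
Proof. by apply/lfunP=> x; rewrite comp_lfunE !lambdaE comp_lfunE. Qed.

(** The dual basis lemma in coordinates; it is what replaces projectivity and
injectivity in all that follows. *)
Definition projective_basis P (I : finType) (g : I -> 'Hom(P, regmod E)) (p : I -> P) :=
  (forall i, is_hom (g i)) /\ (forall x, \sum_i lact (g i x : E) (p i) = x).

Definition has_basis P := exists (I : finType) (g : I -> 'Hom(P, regmod E)) p,
  projective_basis g p.

Section Free.
Variable I : finType.

Fact free_subproof : @is_action k E {ffun I -> E} (fun a f => [ffun i => a * f i]).
Proof.
split=> [a c u v|v c a b|v|a b v]; apply/ffunP=> i; rewrite !ffunE.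
- by rewrite mulrDr scalerAr.
- by rewrite mulrDl scalerAl.
- by rewrite mul1r.
by rewrite mulrA.
Qed.

Definition freemod : lmod E := Lmod free_subproof.

Definition free_map V (v : I -> V) : 'Hom(freemod, V) :=
  linfun (fun f : freemod => \sum_i lact ((f : {ffun I -> E}) i) (v i)).

Lemma free_mapE V (v : I -> V) f :
  free_map v f = \sum_i lact ((f : {ffun I -> E}) i) (v i).
Proof.
rewrite linfunE // => c x y; rewrite scaler_sumr -big_split.
by apply: eq_bigr => i _; rewrite !ffunE (act_linearl (lactP V)).
Qed.

Lemma free_map_hom V (v : I -> V) : is_hom (free_map v).
Proof.
move=> a x; rewrite !free_mapE lact_sumr.
by apply: eq_bigr => i _; rewrite ffunE lactA.
Qed.

Definition free_coord i : 'Hom(freemod, regmod E) :=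
  linfun (fun f : freemod => (f : {ffun I -> E}) i : regmod E).

Lemma free_coordE i f : free_coord i f = (f : {ffun I -> E}) i.
Proof. by rewrite linfunE // => c x y; rewrite !ffunE. Qed.

Lemma free_coord_hom i : is_hom (free_coord i).
Proof. by move=> a f; rewrite !free_coordE ffunE. Qed.

Definition free_gen i : freemod := [ffun j => (i == j)%:R : E].

Lemma free_map_gen V (v : I -> V) i : free_map v (free_gen i) = v i.
Proof.
rewrite free_mapE (bigD1 i) //= ffunE eqxx (act1 (lactP V)) big1 ?addr0 // => j ji.
by rewrite ffunE eq_sym (negPf ji) lact0l.
Qed.

Lemma free_decomp f : f = \sum_i lact (free_coord i f : E) (free_gen i).
Proof.
apply/ffunP=> j; rewrite sum_ffunE (bigD1 j) //= ffunE free_coordE ffunE eqxx.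
rewrite mulr1 big1 ?addr0 // => i ij.
by rewrite !ffunE (negPf ij) mulr0.
Qed.

End Free.

(** A basis lets one lift the finitely many elements [f (p i)]. *)
Lemma basis_projective P : has_basis P -> projective P.
Proof.
move=> [I [g [p [hg gp]]]] X Y q f hq hf sq.
have /choice[x qx] i : exists x, q x = f (p i).
  have: f (p i) \in limg q by rewrite sq memvf.
  by case/memv_imgP=> x _ ->; exists x.
exists (\sum_i lambda (g i) (x i)); first by apply: sum_hom => i; apply: lambda_hom.
apply/lfunP=> u; rewrite comp_lfunE sum_lfunE linear_sum -[in RHS](gp u) linear_sum /=.
by apply: eq_bigr => i _; rewrite lambdaE hq hf qx.
Qed.

(** Scalars of [k] act through [E], so a [k]-basis generates [P] and defines a
free cover, which splits. *)
Lemma projective_has_basis P : projective P -> has_basis P.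
Proof.
move=> projP; pose d := \dim {:P}; pose v (i : 'I_d) : P := (vbasis {:P})`_i.
have sv : limg (free_map v) = fullv.
  apply/eqP; rewrite eqEsubv subvf; apply/subvP=> x _.
  rewrite [x](coord_vbasis (memvf x)); apply: memv_suml => i _.
  by rewrite memvZ // -/(v i) -free_map_gen memv_img // memvf.
have [h hh vh] := projP _ _ _ _ (free_map_hom v) (@id_is_hom P) sv.
exists 'I_d, (fun i => free_coord i \o h)%VF, v; split=> [i|x].
  by apply: comp_hom => //; apply: free_coord_hom.
rewrite -[RHS](id_lfunE x) -vh comp_lfunE free_mapE.
by apply: eq_bigr => i _; rewrite comp_lfunE free_coordE.
Qed.

Lemma reg_has_basis : has_basis (regmod E).
Proof.
exists 'I_1, (fun=> \1%VF), (fun=> (1 : E)); split=> [_|x]; first exact: id_is_hom.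
by rewrite big_ord1 id_lfunE; apply: mulr1.
Qed.

End Homs.

(** * Symmetric algebras: projective modules are injective *)

Section SymmetricForms.
Variables (k : fieldType) (E : falgType k).
Implicit Types (U V W X Y P Q : lmod E).

(** What is used of a symmetrising form: symmetry, nondegeneracy, and the fact
that every functional on [E] has the form [b |-> r (b * a)]. *)
Record trace_form (r : vdual E) : Prop := TraceForm {
  sformC : forall a b : E, r (a * b) = r (b * a);
  sform_eq0 : forall a : E, (forall b : E, r (b * a) = 0) -> a = 0;
  sform_rep : forall mu : vdual E, exists a : E, forall b : E, mu b = r (b * a) }.

Lemma symmetrising_form (r : vdual E) : symmetrising r -> trace_form r.
Proof.
move=> [Phi [[hl hr] [Psi PhiK PsiK] Phi1]].
have El a b : Phi a b = r (b * a).
  rewrite -[a in LHS]mulr1 [in LHS](hl a (1 : E)) Phi1.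
  exact: (@dual_lE _ _ _ (regbim E) a r b).
have Er a b : Phi a b = r (a * b).
  rewrite -[a in LHS]mul1r [in LHS](hr a (1 : E)) Phi1.
  exact: (@dual_rE _ _ _ (regbim E) a r b).
split=> [a b|a a0|mu]; first by rewrite -El -Er.
  rewrite -[a]PhiK -[in RHS](PhiK 0) linear0; congr Psi.
  by apply/lfunP=> b; rewrite El a0 zero_lfunE.
by exists (Psi mu) => b; rewrite -El PsiK.
Qed.

Variables (r : vdual E) (hr : trace_form r).

Lemma sform_inj (a b : E) : (forall c, r (c * a) = r (c * b)) -> a = b.
Proof.
move=> ab; apply/eqP; rewrite -subr_eq0; apply/eqP/(sform_eq0 hr) => c.
by rewrite mulrBr linearB /= ab subrr.
Qed.

(** The isomorphism [Hom_E(X, E) = X^\vee], [F |-> r \o F]: for fixed [x] the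
functional [a |-> mu (a x)] is represented by an element [F x] of [E]. *)
Lemma sform_lift X (mu : vdual X) :
  exists2 F : 'Hom(X, regmod E), is_hom F & forall x, r (F x) = mu x.
Proof.
pose nu x : vdual E := linfun (fun a : E => mu (lact a x)).
have nuE x a : nu x a = mu (lact a x).
  by rewrite linfunE // => c u v; rewrite (act_linearl (lactP X)) linearP.
have /choice[F Fx] x : exists b : E, forall a : E, mu (lact a x) = r (a * b).
  by have [b bx] := sform_rep hr (nu x); exists b => a; rewrite -nuE.
have linF : linear (F : X -> regmod E).
  move=> c u v; apply: sform_inj => a; rewrite -Fx lact_linear linearP /= !Fx.
  by rewrite mulrDr linearD /= -scalerAr linearZ.
exists (linfun (F : X -> regmod E)) => [a x|x]; last first.
  by rewrite linfunE // -[X in r X]mul1r -Fx (act1 (lactP X)).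
rewrite !linfunE //; apply: sform_inj => c.
by rewrite -Fx -lactA Fx mulrA.
Qed.

Lemma sform_hom_inj X (F G : 'Hom(X, regmod E)) :
  is_hom F -> is_hom G -> (forall x, r (F x) = r (G x)) -> F = G.
Proof.
move=> hF hG FG; apply/lfunP=> x; apply: sform_inj => a.
by have := FG (lact a x); rewrite hF hG.
Qed.

(** A functional on [X] extends to [Y], and [r] turns functionals into maps to
[E]. *)
Lemma extend_to_reg X Y (i : 'Hom(X, Y)) (f : 'Hom(X, regmod E)) :
    is_hom i -> lker i = 0%VS -> is_hom f ->
  exists2 g : 'Hom(Y, regmod E), is_hom g & (g \o i)%VF = f.
Proof.
move=> hi i0 hf; have [g hg gE] := sform_lift (r \o f \o i^-1)%VF.
exists g => //; apply: sform_hom_inj => // [|x]; first exact: comp_hom.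
by rewrite comp_lfunE gE !comp_lfunE lker0_lfunK // i0.
Qed.

Lemma basis_injective Q : has_basis Q -> injective_mod Q.
Proof.
move=> [I [g [p [hg gp]]]] X Y i f hi hf i0.
have /choice[G GP] j : exists G : 'Hom(Y, regmod E),
    is_hom G /\ (G \o i)%VF = (g j \o f)%VF.
  have hgf : is_hom (g j \o f)%VF by apply: comp_hom.
  by have [G hG Gi] := extend_to_reg hi i0 hgf; exists G.
exists (\sum_j lambda (G j) (p j)).
  by apply: sum_hom => j; apply: lambda_hom; case: (GP j).
apply/lfunP=> x; rewrite comp_lfunE sum_lfunE -[RHS]gp; apply: eq_bigr => j _.
by rewrite lambdaE -comp_lfunE (proj2 (GP j)) comp_lfunE.
Qed.

(** Coordinate functionals of [Q] embed it into a free module, and the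
embedding splits. *)
Lemma injective_has_basis Q : injective_mod Q -> has_basis Q.
Proof.
move=> injQ; pose d := \dim {:Q}.
have /choice[F FP] (j : 'I_d) : exists F : 'Hom(Q, regmod E),
    is_hom F /\ forall x, r (F x) = coord (vbasis {:Q}) j x.
  have [F hF Fx] := sform_lift (linfun (fun x => coord (vbasis {:Q}) j x : k^o) : vdual Q).
  by exists F; split=> // x; rewrite Fx linfunE // => c u v; rewrite linearP.
pose emb : 'Hom(Q, freemod E 'I_d) := linfun (fun x => [ffun j => F j x : E] : freemod E 'I_d).
have embE x j : (emb x : {ffun 'I_d -> E}) j = F j x.
  by rewrite /emb linfunE ?ffunE // => c u v; apply/ffunP=> l; rewrite !ffunE linearP.
have hemb : is_hom emb.
  by move=> a x; apply/ffunP=> j; rewrite ffunE !embE (proj1 (FP j)).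
have emb0 : lker emb = 0%VS.
  apply/eqP; rewrite -subv0; apply/subvP=> x; rewrite memv_ker => /eqP x0.
  rewrite memv0 [x](coord_vbasis (memvf x)) big1 // => j _.
  by rewrite -(proj2 (FP j)) -embE x0 ffunE linear0 scale0r.
have [h hh hemb1] := injQ _ _ _ _ hemb (@id_is_hom _ _ Q) emb0.
exists 'I_d, F, (fun j => h (free_gen E j)); split=> [j|x]; first by case: (FP j).
rewrite -[RHS](id_lfunE x) -hemb1 comp_lfunE [in RHS](free_decomp (emb x)).
by rewrite linear_sum /=; apply: eq_bigr => j _; rewrite free_coordE embE hh.
Qed.

End SymmetricForms.

(** * Homomorphisms that factor through a projective module *)

Section StablyZero.
Variables (k : fieldType) (E : falgType k).
Implicit Types (U V W X Y P Q : lmod E).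

(** The maps factoring through a projective module: by the dual basis lemma
they are the sums of maps factoring through [E]. *)
Definition prhom U V : {vspace 'Hom(U, V)} :=
  vspan (fun f : 'Hom(U, V) => exists (al : 'Hom(U, regmod E)) (v : V),
    is_hom al /\ f = lambda al v).

Lemma prhom_ind U V (C : 'Hom(U, V) -> Prop) :
    C 0 -> (forall a f g, C f -> C g -> C (a *: f + g)) ->
    (forall (al : 'Hom(U, regmod E)) v, is_hom al -> C (lambda al v)) ->
  forall f, f \in prhom U V -> C f.
Proof. by move=> C0 CD Cl; apply: vspan_ind => // f [al [v [ha ->]]]; apply: Cl. Qed.

Lemma lambda_prhom U V (al : 'Hom(U, regmod E)) (v : V) :
  is_hom al -> lambda al v \in prhom U V.
Proof. by move=> ha; apply: mem_vspan; exists al, v. Qed.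

Lemma basis_decomp P V (I : finType) (g : I -> 'Hom(P, regmod E)) p (f : 'Hom(P, V)) :
  projective_basis g p -> is_hom f -> f = \sum_i lambda (g i) (f (p i)).
Proof.
move=> [_ gp] hf; apply/lfunP=> x; rewrite sum_lfunE -[in LHS](gp x) linear_sum.
by apply: eq_bigr => i _; rewrite lambdaE /= hf.
Qed.

Lemma comp_prhom U P V (g : 'Hom(P, V)) (f : 'Hom(U, P)) :
  has_basis P -> is_hom g -> is_hom f -> (g \o f)%VF \in prhom U V.
Proof.
move=> [I [ga [p bP]]] hg hf; rewrite (basis_decomp bP hg).
have ->: ((\sum_i lambda (ga i) (g (p i))) \o f)%VF =
         \sum_i lambda (ga i \o f)%VF (g (p i)).
  apply/lfunP=> x; rewrite comp_lfunE !sum_lfunE; apply: eq_bigr => i _.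
  by rewrite -lambda_compr comp_lfunE.
by apply: memv_suml => i _; apply/lambda_prhom/comp_hom/hf/(proj1 bP).
Qed.

Lemma prhom_compl U V W (g : 'Hom(V, W)) (f : 'Hom(U, V)) :
  is_hom g -> f \in prhom U V -> (g \o f)%VF \in prhom U W.
Proof.
move=> hg; move: f; apply: prhom_ind => [|a f f'|al v ha].
- by rewrite comp_lfun0r mem0v.
- by rewrite comp_lfunDr -comp_lfunZr => Pf Pf'; rewrite memvD ?memvZ.
by rewrite lambda_compl //; apply: lambda_prhom.
Qed.

Lemma prhom_compr U V W (g : 'Hom(V, W)) (f : 'Hom(U, V)) :
  is_hom f -> g \in prhom V W -> (g \o f)%VF \in prhom U W.
Proof.
move=> hf; move: g; apply: prhom_ind => [|a g g'|al v ha].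
- by rewrite comp_lfun0l mem0v.
- by rewrite comp_lfunDl -comp_lfunZl => Pf Pf'; rewrite memvD ?memvZ.
by rewrite lambda_compr; apply/lambda_prhom/comp_hom.
Qed.

Lemma mkhomK U V (f : 'Hom(U, V)) : is_hom f -> vsval (mkhom f) = f.
Proof. by move=> /mem_HomE hf; rewrite vsprojK. Qed.

(** The linear span that defines the maps factoring through a projective module
agrees with the span of the [lambda al v], because a dual basis of the projective
module splits every such map into maps factoring through [E]. *)
Lemma homE_prP U V (x : homE U V) : (x \in homE_pr U V) <-> (vsval x \in prhom U V).
Proof.
split.
  move: x; apply: vspan_ind => [|a x y|x [P [/projective_has_basis bP]]].
  - by rewrite linear0 mem0v.
  - by rewrite linearP => Px Py; rewrite memvD ?memvZ.
  by move=> [g [h [hg hh ->]]]; apply: comp_prhom.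
suff H f : f \in prhom U V -> mkhom f \in homE_pr U V.
  by move=> /H; rewrite /mkhom vsvalK.
move: f; apply: prhom_ind => [|a f g|al v ha].
- by rewrite /mkhom linear0 mem0v.
- by rewrite /mkhom linearP => Pf Pg; rewrite memvD ?memvZ.
apply: mem_vspan; exists (regmod E); split; first exact/basis_projective/reg_has_basis.
exists al, (lambda \1%VF v); split=> //; first exact/lambda_hom/id_is_hom.
rewrite mkhomK; last exact: lambda_hom.
by apply/lfunP=> y; rewrite comp_lfunE !lambdaE id_lfunE.
Qed.

Lemma scls_eq U V (f g : 'Hom(U, V)) : is_hom f -> is_hom g ->
  scls f = scls g <-> f - g \in prhom U V.
Proof.
move=> hf hg; have := homE_prP (mkhom (f - g)).
rewrite mkhomK; last by rewrite addrC -scaleN1r; apply: linear_hom.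
by rewrite /mkhom linearB -vpi_eq => prP; split=> [/eqP/prP|/prP/eqP].
Qed.

Lemma scls_linear U V : linear (@scls k E U V).
Proof. by move=> a f g; rewrite /scls /mkhom !linearP. Qed.

Lemma srep_scls U V (f : 'Hom(U, V)) : is_hom f -> srep (scls f) - f \in prhom U V.
Proof. by move=> hf; apply/scls_eq; rewrite ?srepK //; apply: srep_hom. Qed.

End StablyZero.

(** * The stable category *)

Section StableComposition.
Variables (k : fieldType) (E : falgType k).
Implicit Types (U V W X Y Z : lmod E).

Lemma scls_surj U V (x : sthom U V) : exists2 f : 'Hom(U, V), is_hom f & scls f = x.
Proof. by exists (srep x); [exact: srep_hom|exact: srepK]. Qed.

Lemma scomp_scls U V W (g : 'Hom(V, W)) (f : 'Hom(U, V)) : is_hom g -> is_hom f ->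
  scomp (scls g) (scls f) = scls (g \o f)%VF.
Proof.
move=> hg hf; apply/scls_eq; [exact/comp_hom/srep_hom/srep_hom|exact: comp_hom|].
pose f' := srep (scls f); pose g' := srep (scls g).
have ->: (g' \o f')%VF - (g \o f)%VF = ((g' - g) \o f')%VF + (g \o (f' - f))%VF.
  apply/lfunP=> x; rewrite !(add_lfunE, opp_lfunE, comp_lfunE) linearB /=.
  by rewrite addrA subrK.
apply: memvD; first exact/prhom_compr/srep_scls/hg/srep_hom.
exact/prhom_compl/srep_scls.
Qed.

Lemma scompA U V W X (z : sthom W X) (y : sthom V W) (x : sthom U V) :
  scomp z (scomp y x) = scomp (scomp z y) x.
Proof.
have [h hh <-] := scls_surj z; have [g hg <-] := scls_surj y.
have [f hf <-] := scls_surj x.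
rewrite !scomp_scls ?comp_lfunA //; by apply: comp_hom.
Qed.

Lemma scomp1l U V (x : sthom U V) : scomp (sid V) x = x.
Proof.
by have [f hf <-] := scls_surj x; rewrite scomp_scls ?comp_lfun1l //; apply: id_is_hom.
Qed.

Lemma scomp1r U V (x : sthom U V) : scomp x (sid U) = x.
Proof.
by have [f hf <-] := scls_surj x; rewrite scomp_scls ?comp_lfun1r //; apply: id_is_hom.
Qed.

Lemma scomp_linearr U V W (y : sthom V W) : linear (@scomp k E U V W y).
Proof.
move=> a x x'; have [g hg <-] := scls_surj y; have [f hf <-] := scls_surj x.
have [f' hf' <-] := scls_surj x'; rewrite -scls_linear !scomp_scls //.
  by rewrite comp_lfunDr -comp_lfunZr scls_linear.
exact: linear_hom.
Qed.

Definition siso U V (x : sthom U V) :=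
  exists y : sthom V U, scomp y x = sid U /\ scomp x y = sid V.

Lemma siso_id U : siso (sid U).
Proof. by exists (sid U); rewrite scomp1l. Qed.

Lemma siso_comp U V W (y : sthom V W) (x : sthom U V) :
  siso y -> siso x -> siso (scomp y x).
Proof.
move=> [y' [y'y yy']] [x' [x'x xx']]; exists (scomp x' y').
by split; rewrite -scompA [X in scomp _ X]scompA ?y'y ?xx' scomp1l.
Qed.

Lemma sinvK U V (x : sthom U V) :
  siso x -> scomp (sinv x) x = sid U /\ scomp x (sinv x) = sid V.
Proof. exact: (@xgetPex _ 0 (fun y => scomp y x = sid U /\ scomp x y = sid V)). Qed.

End StableComposition.

(** * The trace form of a projective module *)

Section Trace.
Variables (k : fieldType) (E : falgType k) (r : vdual E).
Hypothesis hr : trace_form r.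
Implicit Types (U V W X Y P Q : lmod E).

(** The sum on the right is a functional with the values that define [hat]; by
symmetry of [r] and the dual basis identity it takes [lambda al v] to
[r (al (beta v))].  It is also the only one, as the [lambda (g i) v] span. *)
Lemma hat_basis P V (I : finType) (g : I -> 'Hom(P, regmod E)) p
    (beta : 'Hom(V, P)) (f : 'Hom(P, V)) :
    projective_basis g p -> is_hom beta -> is_hom f ->
  hat r beta (mkhom f) = \sum_i r (g i (beta (f (p i)))).
Proof.
move=> bP hb hf; have [hg gp] := bP.
pose phi : vdual (homE P V) :=
  linfun (fun f : homE P V => (\sum_i r (g i (beta (vsval f (p i)))) : k^o)).
have phiE f' : phi f' = \sum_i r (g i (beta (vsval f' (p i)))).
  rewrite linfunE // => a u v; rewrite scaler_sumr -big_split.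
  apply: eq_bigr => i _.
  have ->: vsval (a *: u + v) = a *: vsval u + vsval v by rewrite linearP.
  by rewrite add_lfunE scale_lfunE !linearP.
have phiP (al : 'Hom(P, regmod E)) v :
    is_hom al -> phi (mkhom (lambda al v)) = r (al (beta v)).
  move=> hal; rewrite phiE mkhomK; last exact: lambda_hom.
  rewrite -[in RHS](gp (beta v)) !linear_sum; apply: eq_bigr => i _ /=.
  by rewrite lambdaE hb (hg i) hal; apply: (sformC hr).
have hatP : forall (al : 'Hom(P, regmod E)) v,
    is_hom al -> hat r beta (mkhom (lambda al v)) = r (al (beta v)).
  apply: (@xgetPex _ 0 (fun phi : vdual (homE P V) =>
    forall (al : 'Hom(P, regmod E)) v, is_hom al ->
      phi (mkhom (lambda al v)) = r (al (beta v)))).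
  by exists phi.
rewrite [in LHS](basis_decomp bP hf) /mkhom !linear_sum.
by apply: eq_bigr => i _; apply: hatP.
Qed.

(** The trace [End_E(P) -> k] of a projective module [P] with values read
through [r]; for [E = k] and [r] the identity it is the usual trace. *)
Definition ptr P (phi : 'Hom(P, P)) : k := hat r \1%VF (mkhom phi).

Lemma ptr_linear P a (phi psi : 'Hom(P, P)) :
  ptr (a *: phi + psi) = a * ptr phi + ptr psi.
Proof. by rewrite /ptr /mkhom !linearP. Qed.

Lemma ptr_basis P (I : finType) (g : I -> 'Hom(P, regmod E)) p (phi : 'Hom(P, P)) :
  projective_basis g p -> is_hom phi -> ptr phi = \sum_i r (g i (phi (p i))).
Proof.
move=> bP hphi; rewrite /ptr (hat_basis bP (@id_is_hom _ _ P)) //.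
by apply: eq_bigr => i _; rewrite id_lfunE.
Qed.

(** This turns the functionals [hat beta], one for each [beta], into the single
trace form of [P]. *)
Lemma hat_ptr P V (beta : 'Hom(V, P)) (f : 'Hom(P, V)) :
  has_basis P -> is_hom beta -> is_hom f -> hat r beta (mkhom f) = ptr (beta \o f)%VF.
Proof.
move=> [I [g [p bP]]] hb hf; rewrite (hat_basis bP) // (ptr_basis bP).
  by apply: eq_bigr => i _; rewrite comp_lfunE.
exact: comp_hom.
Qed.

(** Both sides expand to [\sum_(i, j) r (g j (f (p' i)) * g' i (h (p j)))] up to
the order of the factors, and [r] is symmetric. *)
Lemma ptrC P Q (h : 'Hom(P, Q)) (f : 'Hom(Q, P)) :
    has_basis P -> has_basis Q -> is_hom h -> is_hom f ->
  ptr (h \o f)%VF = ptr (f \o h)%VF.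
Proof.
move=> [I [g [p bP]]] [J [g' [p' bQ]]] hh hf; have [[hg gp] [hg' gp']] := (bP, bQ).
rewrite (ptr_basis bP) ?(ptr_basis bQ); try exact: comp_hom.
transitivity (\sum_i \sum_j r ((g j (f (p' i)) : E) * g' i (h (p j)))).
  apply: eq_bigr => i _; rewrite comp_lfunE -[X in h X](gp (f (p' i))) !linear_sum.
  by apply: eq_bigr => j _ /=; rewrite hh (hg' i).
rewrite exchange_big; apply: eq_bigr => j _ /=.
rewrite comp_lfunE -[X in f X](gp' (h (p j))) !linear_sum.
by apply: eq_bigr => i _ /=; rewrite hf (hg j); apply: (sformC hr).
Qed.

Lemma ptr_lambda P (al : 'Hom(P, regmod E)) (x : P) :
  has_basis P -> is_hom al -> ptr (lambda al x) = r (al x).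
Proof.
move=> [I [g [p bP]]] ha; rewrite (ptr_basis bP); last exact: lambda_hom.
have [hg gp] := bP; rewrite -[in RHS](gp x) !linear_sum.
by apply: eq_bigr => i _ /=; rewrite lambdaE (hg i) ha; apply: (sformC hr).
Qed.

End Trace.

(** * Short exact sequences with projective middle term *)

Section ExactSequences.
Variables (k : fieldType) (E : falgType k) (r : vdual E).
Hypothesis hr : trace_form r.
Implicit Types (U V W X Y Z P Q : lmod E).

Lemma factor_surj X Y Z (p : 'Hom(X, Y)) (f : 'Hom(X, Z)) :
    is_hom p -> is_hom f -> limg p = fullv -> (lker p <= lker f)%VS ->
  exists2 g : 'Hom(Y, Z), is_hom g & (g \o p)%VF = f.
Proof.
move=> hp hf sp /subvP kpf.
have fE x : (f \o p^-1)%VF (p x) = f x.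
  rewrite comp_lfunE; apply/eqP; rewrite -subr_eq0 -linearB -memv_ker kpf //.
  by rewrite memv_ker linearB /= limg_lfunVK ?subrr // sp memvf.
exists (f \o p^-1)%VF; last by apply/lfunP=> x; rewrite [LHS]comp_lfunE fE.
move=> a y; have: y \in limg p by rewrite sp memvf.
by case/memv_imgP=> x _ ->; rewrite -hp !fE hf.
Qed.

Lemma factor_inj X Y Z (i : 'Hom(X, Y)) (f : 'Hom(Z, Y)) :
    is_hom i -> is_hom f -> lker i = 0%VS -> (limg f <= limg i)%VS ->
  exists2 g : 'Hom(Z, X), is_hom g & (i \o g)%VF = f.
Proof.
move=> hi hf i0 /subvP sfi; have /eqP/lker0P inji := i0.
have fE z : i ((i^-1 \o f)%VF z) = f z.
  by rewrite comp_lfunE limg_lfunVK // sfi // memv_img ?memvf.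
exists (i^-1 \o f)%VF; last by apply/lfunP=> z; rewrite comp_lfunE fE.
by move=> a z; apply: inji; rewrite hi !fE hf.
Qed.

(** The middle term is at once projective and injective, the algebra being
symmetric. *)
Record exact3 X Y (s : seq3 X Y) : Prop := Exact3 {
  ex_inc_hom : is_hom (sinc s);
  ex_pro_hom : is_hom (spro s);
  ex_inj : lker (sinc s) = 0%VS;
  ex_surj : limg (spro s) = fullv;
  ex_mid : lker (spro s) = limg (sinc s);
  ex_basis : has_basis (smid s) }.

Lemma ex_comp0 X Y (s : seq3 X Y) : exact3 s -> (spro s \o sinc s)%VF = 0.
Proof.
move=> xs; apply/lfunP=> x; rewrite comp_lfunE zero_lfunE; apply/eqP.
by rewrite -memv_ker (ex_mid xs) memv_img ?memvf.
Qed.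

Lemma omega_exact (R : resolution E) U : exact3 (omega_seq R U).
Proof.
have incE u : omega_inc R U u = vsval u by rewrite /omega_inc lfunE.
split.
- move=> a u; rewrite [LHS]incE [in RHS]incE.
  exact: (ker_actE (@po_hom _ _ _ (res_proj R U)) a u).
- exact: po_hom.
- apply/eqP/lker0P=> u v; rewrite /= !incE; exact: val_inj.
- exact: po_surj.
- apply/vspaceP=> x /=; apply/idP/memv_imgP=> [Kx|[u _ ->]].
    by exists (vsproj _ x); rewrite ?memvf // incE vsprojK.
  by rewrite incE; apply: subvsP.
exact/projective_has_basis/po_projective.
Qed.

Lemma sigma_exact (R : resolution E) U : exact3 (sigma_seq R U).
Proof.
split.
- exact: ii_hom.
- by move=> a x; exact: (esym (coker_actE (@ii_hom _ _ _ (res_inj R U)) a x)).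
- exact: ii_inj.
- apply/eqP; rewrite eqEsubv subvf; apply/subvP=> x _ /=.
  by rewrite -(vrepK x) memv_img ?memvf.
- exact: lker_vpi.
exact/(injective_has_basis hr)/ii_injective.
Qed.

Section Maps.
Variables (X Y X' Y' : lmod E) (s : seq3 X Y) (s' : seq3 X' Y').
Hypotheses (xs : exact3 s) (xs' : exact3 s').
Implicit Types (f : 'Hom(X, X')) (g : 'Hom(Y, Y')).

Lemma seq3_map_linear a f g f' g' : seq3_map s s' f g -> seq3_map s s' f' g' ->
  seq3_map s s' (a *: f + f') (a *: g + g').
Proof.
move=> [hf hg [h [hh hi hp]]] [hf' hg' [h' [hh' hi' hp']]].
split; [exact: linear_hom|exact: linear_hom|exists (a *: h + h')].
split; first exact: linear_hom.
  by rewrite comp_lfunDl -comp_lfunZl hi hi' comp_lfunDr -comp_lfunZr.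
by rewrite comp_lfunDr -comp_lfunZr hp hp' comp_lfunDl -comp_lfunZl.
Qed.

Lemma seq3_map_exr f : is_hom f -> exists g, seq3_map s s' f g.
Proof.
move=> hf.
have hif : is_hom (sinc s' \o f)%VF by apply: comp_hom hf; apply: ex_inc_hom.
have [h hh hE] := basis_injective hr (ex_basis xs') (ex_inc_hom xs) hif (ex_inj xs).
have hph : is_hom (spro s' \o h)%VF by apply: comp_hom hh; apply: ex_pro_hom.
have kh : (lker (spro s) <= lker (spro s' \o h))%VS.
  rewrite (ex_mid xs); apply/subvP=> _ /memv_imgP[x _ ->].
  by rewrite memv_ker -comp_lfunE -comp_lfunA hE comp_lfunA ex_comp0 // comp_lfun0l
    zero_lfunE.
have [g hg gE] := factor_surj (ex_pro_hom xs) hph (ex_surj xs) kh.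
by exists g; split=> //; exists h.
Qed.

Lemma seq3_map_exl g : is_hom g -> exists f, seq3_map s s' f g.
Proof.
move=> hg.
have hgp : is_hom (g \o spro s)%VF by apply: comp_hom hg _; apply: ex_pro_hom.
have [h hh hE] := basis_projective (ex_basis xs) (ex_pro_hom xs') hgp (ex_surj xs').
have hhi : is_hom (h \o sinc s)%VF by apply: comp_hom hh _; apply: ex_inc_hom.
have ih : (limg (h \o sinc s) <= limg (sinc s'))%VS.
  rewrite -(ex_mid xs'); apply/subvP=> _ /memv_imgP[x _ ->].
  by rewrite memv_ker -comp_lfunE comp_lfunA hE -comp_lfunA ex_comp0 // comp_lfun0r
    zero_lfunE.
have [f hf fE] := factor_inj (ex_inc_hom xs') hhi (ex_inj xs') ih.
by exists f; split=> //; exists h.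
Qed.

(** If [f] extends over the middle term of [s], subtracting that extension from
the middle map makes the latter vanish on the left term, so that it induces a
lift of [g] to the middle term of [s']. *)
Lemma seq3_map_prr f g :
  seq3_map s s' f g -> f \in prhom X X' -> g \in prhom Y Y'.
Proof.
move=> [_ hg [h [hh hi hp]]] pf.
have [f' hf' f'E] : exists2 f' : 'Hom(smid s, X'), is_hom f' & (f' \o sinc s)%VF = f.
  move: f pf {hi}; apply: prhom_ind => [|a f1 f2 [g1 hg1 E1] [g2 hg2 E2]|al v ha].
  - by exists 0; [apply/mem_HomE/mem0v|rewrite comp_lfun0l].
  - exists (a *: g1 + g2); first exact: linear_hom.
    by rewrite comp_lfunDl -comp_lfunZl E1 E2.
  have [be hb bE] := extend_to_reg hr (ex_inc_hom xs) (ex_inj xs) ha.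
  by exists (lambda be v); [exact: lambda_hom|rewrite lambda_compr bE].
pose h' := (-1) *: (sinc s' \o f')%VF + h.
have hh' : is_hom h' by apply/linear_hom/hh/comp_hom/hf'/ex_inc_hom.
have kh : (lker (spro s) <= lker h')%VS.
  rewrite (ex_mid xs); apply/subvP=> _ /memv_imgP[x _ ->].
  rewrite memv_ker -comp_lfunE comp_lfunDl -comp_lfunZl -comp_lfunA f'E hi.
  by rewrite scaleN1r addNr zero_lfunE.
have [q hq qE] := factor_surj (ex_pro_hom xs) hh' (ex_surj xs) kh.
suff -> : g = (spro s' \o q)%VF
  by apply: comp_prhom => //; [exact: ex_basis|exact: ex_pro_hom].
apply/lfunP=> y; have: y \in limg (spro s) by rewrite (ex_surj xs) memvf.
case/memv_imgP=> x _ ->; rewrite -!comp_lfunE -comp_lfunA qE comp_lfunDr -comp_lfunZr.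
by rewrite comp_lfunA ex_comp0 // comp_lfun0l scaler0 add0r hp.
Qed.

(** The dual of the preceding argument: lift [g] to the middle term of [s'], and
subtract the lift from the middle map. *)
Lemma seq3_map_prl f g :
  seq3_map s s' f g -> g \in prhom Y Y' -> f \in prhom X X'.
Proof.
move=> [hf _ [h [hh hi hp]]] pg.
have [g' hg' g'E] : exists2 g' : 'Hom(Y, smid s'), is_hom g' & (spro s' \o g')%VF = g.
  move: g pg {hp}; apply: prhom_ind => [|a f1 f2 [g1 hg1 E1] [g2 hg2 E2]|al v ha].
  - by exists 0; [apply/mem_HomE/mem0v|rewrite comp_lfun0r].
  - exists (a *: g1 + g2); first exact: linear_hom.
    by rewrite comp_lfunDr -comp_lfunZr E1 E2.
  have: v \in limg (spro s') by rewrite (ex_surj xs') memvf.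
  case/memv_imgP=> x _ ->; exists (lambda al x); first exact: lambda_hom.
  by rewrite lambda_compl //; apply: ex_pro_hom.
pose h' := (-1) *: (g' \o spro s)%VF + h.
have hh' : is_hom h' by apply/linear_hom/hh/comp_hom/ex_pro_hom.
have ih : (limg h' <= limg (sinc s'))%VS.
  rewrite -(ex_mid xs'); apply/subvP=> _ /memv_imgP[x _ ->].
  rewrite memv_ker -comp_lfunE comp_lfunDr -comp_lfunZr comp_lfunA g'E hp.
  by rewrite scaleN1r addNr zero_lfunE.
have [q hq qE] := factor_inj (ex_inc_hom xs') hh' (ex_inj xs') ih.
suff -> : f = (q \o sinc s)%VF
  by apply: comp_prhom => //; [exact: ex_basis|exact: ex_inc_hom].
apply/lfunP=> x; have /eqP/lker0P injs := ex_inj xs'; apply: injs.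
rewrite -!comp_lfunE comp_lfunA qE comp_lfunDl -comp_lfunZl.
by rewrite -comp_lfunA ex_comp0 // comp_lfun0r scaler0 add0r hi.
Qed.

(** By the lemmas below, [stmap s s'] is, for exact [s] and [s'], the graph of a
linear bijection between the stable maps of the left terms and those of the right
terms.  Every shift, comparison and cancellation map is characterised by such a
graph, so that identities between them follow by composing sequences and using
uniqueness. *)
Definition stmap (x : sthom X X') (y : sthom Y Y') : Prop :=
  exists f g, [/\ seq3_map s s' f g, scls f = x & scls g = y].

Lemma stmap_linear a x y x' y' :
  stmap x y -> stmap x' y' -> stmap (a *: x + x') (a *: y + y').
Proof.
move=> [f [g [m <- <-]]] [f' [g' [m' <- <-]]].
exists (a *: f + f'), (a *: g + g'); rewrite !scls_linear; split=> //.
exact: seq3_map_linear.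
Qed.

Lemma stmap_uniqr x y y' : stmap x y -> stmap x y' -> y = y'.
Proof.
move=> [f [g [m <- <-]]] [f' [g' [m' e <-]]].
have := seq3_map_linear (-1) m' m; rewrite !scaleN1r ![- _ + _]addrC.
have [[hf hg _] [hf' hg' _]] := (m, m').
by move/seq3_map_prr => H; apply/scls_eq/H/scls_eq.
Qed.

Lemma stmap_uniql x x' y : stmap x y -> stmap x' y -> x = x'.
Proof.
move=> [f [g [m <- <-]]] [f' [g' [m' <- e]]].
have := seq3_map_linear (-1) m' m; rewrite !scaleN1r ![- _ + _]addrC.
have [[hf hg _] [hf' hg' _]] := (m, m').
by move/seq3_map_prl => H; apply/scls_eq/H/scls_eq.
Qed.

Lemma st_right_eq x y : stmap x y -> st_right s s' x = y.
Proof. by move=> m; apply: xget_unique => // y' /stmap_uniqr; apply. Qed.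

Lemma st_left_eq x y : stmap x y -> st_left s s' y = x.
Proof.
move=> m; apply: xget_unique => [|x' [f [g [m' gy fx]]]].
  by case: m => f [g [m fx gy]]; exists f, g.
by apply: (stmap_uniql _ m); exists f, g.
Qed.

Lemma st_rightP x : stmap x (st_right s s' x).
Proof.
have [f hf <-] := scls_surj x; have [g m] := seq3_map_exr hf.
have M : stmap (scls f) (scls g) by exists f, g.
by rewrite (st_right_eq M).
Qed.

Lemma st_leftP y : stmap (st_left s s' y) y.
Proof.
have [g hg <-] := scls_surj y; have [f m] := seq3_map_exl hg.
have M : stmap (scls f) (scls g) by exists f, g.
by rewrite (st_left_eq M).
Qed.

Lemma st_right_linear : linear (st_right s s').
Proof. by move=> a x y; apply/st_right_eq/stmap_linear; apply: st_rightP. Qed.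

Lemma st_left_linear : linear (st_left s s').
Proof. by move=> a x y; apply/st_left_eq/stmap_linear; apply: st_leftP. Qed.

End Maps.

Lemma stmap_comp X Y X' Y' X'' Y'' (s : seq3 X Y) (s' : seq3 X' Y')
    (s'' : seq3 X'' Y'') x y x' y' :
  stmap s s' x y -> stmap s' s'' x' y' -> stmap s s'' (scomp x' x) (scomp y' y).
Proof.
move=> [f [g [[hf hg [h [hh hi hp]]] <- <-]]] [f' [g' [[hf' hg' [h' [hh' hi' hp']]] <- <-]]].
exists (f' \o f)%VF, (g' \o g)%VF; rewrite !scomp_scls //; split=> //.
split; [exact: comp_hom|exact: comp_hom|exists (h' \o h)%VF].
split; first exact: comp_hom.
  by rewrite -comp_lfunA hi comp_lfunA hi' comp_lfunA.
by rewrite comp_lfunA hp' -comp_lfunA hp comp_lfunA.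
Qed.

Lemma stmap_id X Y (s : seq3 X Y) : stmap s s (sid X) (sid Y).
Proof.
exists \1%VF, \1%VF; split=> //; split; [exact: id_is_hom|exact: id_is_hom|].
exists \1%VF; split; first exact: id_is_hom.
  by rewrite comp_lfun1l comp_lfun1r.
by rewrite comp_lfun1l comp_lfun1r.
Qed.

Lemma siso_right X Y X' Y' (s : seq3 X Y) (s' : seq3 X' Y') x y :
  exact3 s -> exact3 s' -> stmap s s' x y -> siso x -> siso y.
Proof.
move=> xs xs' m [x' [x'x xx']]; exists (st_right s' s x').
have m' := st_rightP xs' xs x'; split.
  by apply: (stmap_uniqr xs xs (stmap_comp m m')); rewrite x'x; apply: stmap_id.
by apply: (stmap_uniqr xs' xs' (stmap_comp m' m)); rewrite xx'; apply: stmap_id.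
Qed.

Lemma siso_left X Y X' Y' (s : seq3 X Y) (s' : seq3 X' Y') x y :
  exact3 s -> exact3 s' -> stmap s s' x y -> siso y -> siso x.
Proof.
move=> xs xs' m [y' [y'y yy']]; exists (st_left s' s y').
have m' := st_leftP xs' xs y'; split.
  by apply: (stmap_uniql xs xs (stmap_comp m m')); rewrite y'y; apply: stmap_id.
by apply: (stmap_uniql xs' xs' (stmap_comp m' m)); rewrite yy'; apply: stmap_id.
Qed.

(** * Tate duality as a trace pairing *)

Section Pairing.

(** The Tate pairing attached to an arbitrary short exact sequence with projective
middle term, rather than to the chosen projective cover only: this is what makes
it possible to move it to the tensored sequence. *)
Definition pairing X Y (s : seq3 X Y) V (x : sthom V X) (y : sthom Y V) : k :=
  ptr r (sinc s \o srep x \o srep y \o spro s)%VF.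

(** If [f] factors through [E], the trace becomes the value of [r] at an element
obtained by applying [spro s \o sinc s = 0]. *)
Lemma ptr_prl X Y (s : seq3 X Y) V (f : 'Hom(V, X)) (g : 'Hom(Y, V)) :
    exact3 s -> is_hom g -> f \in prhom V X ->
  ptr r (sinc s \o f \o g \o spro s)%VF = 0.
Proof.
move=> xs hg; move: f.
apply: prhom_ind => [|a f f' Pf Pf'|al v ha].
- by rewrite comp_lfun0r !comp_lfun0l /ptr /mkhom !linear0.
- rewrite comp_lfunDr -comp_lfunZr !comp_lfunDl -!comp_lfunZl ptr_linear Pf Pf'.
  by rewrite mulr0 addr0.
have [[hi hp] bs] := (ex_inc_hom xs, ex_pro_hom xs, ex_basis xs).
rewrite lambda_compl // !lambda_compr ptr_lambda //; last by do 2!apply: comp_hom => //.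
by rewrite comp_lfunE -[spro s _]comp_lfunE ex_comp0 // zero_lfunE !linear0.
Qed.

Lemma ptr_prr X Y (s : seq3 X Y) V (f : 'Hom(V, X)) (g : 'Hom(Y, V)) :
    exact3 s -> is_hom f -> g \in prhom Y V ->
  ptr r (sinc s \o f \o g \o spro s)%VF = 0.
Proof.
move=> xs hf; move: g.
apply: prhom_ind => [|a g g' Pg Pg'|al v ha].
- by rewrite !comp_lfun0r !comp_lfun0l /ptr /mkhom !linear0.
- rewrite comp_lfunDr -comp_lfunZr !comp_lfunDl -!comp_lfunZl ptr_linear Pg Pg'.
  by rewrite mulr0 addr0.
have [[hi hp] bs] := (ex_inc_hom xs, ex_pro_hom xs, ex_basis xs).
rewrite lambda_compl ?lambda_compr ?ptr_lambda //; try exact: comp_hom.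
by rewrite !comp_lfunE -[spro s _]comp_lfunE ex_comp0 // zero_lfunE !linear0.
Qed.

Lemma pairing_scls X Y (s : seq3 X Y) V (f : 'Hom(V, X)) (g : 'Hom(Y, V)) :
    exact3 s -> is_hom f -> is_hom g ->
  pairing s (scls f) (scls g) = ptr r (sinc s \o f \o g \o spro s)%VF.
Proof.
move=> xs hf hg; rewrite /pairing.
set f' := srep _; set g' := srep _.
have -> : (sinc s \o f' \o g' \o spro s)%VF =
    1 *: (sinc s \o (f' - f) \o g' \o spro s)%VF +
    (1 *: (sinc s \o f \o (g' - g) \o spro s)%VF + (sinc s \o f \o g \o spro s)%VF).
  rewrite !scale1r; apply/lfunP=> x.
  rewrite !(add_lfunE, comp_lfunE, opp_lfunE) !linearB /=.
  by rewrite subrK subrK.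
rewrite !ptr_linear (ptr_prl xs (srep_hom _) (srep_scls hf)).
by rewrite (ptr_prr xs hf (srep_scls hg)) !mulr0 !add0r.
Qed.

Lemma pairing_linearl X Y (s : seq3 X Y) V (y : sthom Y V) a x x' : exact3 s ->
  pairing s (a *: x + x') y = a * pairing s x y + pairing s x' y.
Proof.
move=> xs; have [g hg <-] := scls_surj y; have [f hf <-] := scls_surj x.
have [f' hf' <-] := scls_surj x'; rewrite -scls_linear !pairing_scls //.
  by rewrite comp_lfunDr -comp_lfunZr !comp_lfunDl -!comp_lfunZl ptr_linear.
exact: linear_hom.
Qed.

Lemma pairing_linearr X Y (s : seq3 X Y) V (x : sthom V X) a y y' : exact3 s ->
  pairing s x (a *: y + y') = a * pairing s x y + pairing s x y'.
Proof.
move=> xs; have [g hg <-] := scls_surj y; have [f hf <-] := scls_surj x.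
have [g' hg' <-] := scls_surj y'; rewrite -scls_linear !pairing_scls //.
  by rewrite comp_lfunDr -comp_lfunZr !comp_lfunDl -!comp_lfunZl ptr_linear.
exact: linear_hom.
Qed.

(** Both sides are traces of composites with a map between the middle terms
that induces [a] and [b], on the two middle terms in turn. *)
Lemma pairing_natural X Y X' Y' (s : seq3 X Y) (s' : seq3 X' Y') V
    (a : sthom X X') (b : sthom Y Y') (x : sthom V X) (y : sthom Y' V) :
    exact3 s -> exact3 s' -> stmap s s' a b ->
  pairing s' (scomp a x) y = pairing s x (scomp y b).
Proof.
move=> xs xs' [f [g [[hf hg [h [hh hi hp]]] <- <-]]].
have [u hu <-] := scls_surj x; have [v hv <-] := scls_surj y.
have [[hi1 hi2] [hp1 hp2]] :=
  ((ex_inc_hom xs, ex_inc_hom xs'), (ex_pro_hom xs, ex_pro_hom xs')).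
rewrite !scomp_scls // !pairing_scls //; try exact: comp_hom.
rewrite comp_lfunA -hi -!comp_lfunA ptrC //; try exact: ex_basis; last first.
  by do 3!apply: comp_hom => //.
by rewrite -!comp_lfunA hp.
Qed.

End Pairing.

End ExactSequences.

(** * Tensoring with a bimodule *)

Section TensorFunctor.
Variables (k : fieldType) (A B : falgType k) (M : bimod A B).
Implicit Types (U V W X Y P : lmod B).

(** Gives pure tensors the module type [tensm M V]. *)
Definition pure V (m : M) (v : V) : tensm M V := @tpure k B (rightm M) V m v.

Lemma pure_bilin V : bilin (@pure V).
Proof. exact: (@tpure_bilin k B (rightm M) V). Qed.

Lemma pure_suml V I (r : seq I) (F : I -> M) (v : V) :
  pure (\sum_(i <- r) F i) v = \sum_(i <- r) pure (F i) v.
Proof.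
have lv := (pure_bilin V).2 v; rewrite -(linfunE lv) linear_sum /=.
by apply: eq_bigr => i _; rewrite linfunE.
Qed.

Lemma pure_sumr V I (r : seq I) (F : I -> V) (m : M) :
  pure m (\sum_(i <- r) F i) = \sum_(i <- r) pure m (F i).
Proof.
have lm := (pure_bilin V).1 m; rewrite -(linfunE lm) linear_sum /=.
by apply: eq_bigr => i _; rewrite linfunE.
Qed.

Lemma pure0r V (m : M) : pure m (0 : V) = 0.
Proof. by rewrite -(linfunE ((pure_bilin V).1 m)) linear0. Qed.

Lemma pure_balanced V (m : M) (b : B) (v : V) : pure (br b m) v = pure m (lact b v).
Proof. exact: (@tpure_balanced k B (rightm M) V). Qed.

Lemma lact_pure V (a : A) m (v : V) : lact a (pure m v) = pure (bl a m) v.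
Proof. exact: tens_lE. Qed.

Lemma tensm_ext V (Z : vectType k) (f g : 'Hom(tensm M V, Z)) :
  (forall m v, f (pure m v) = g (pure m v)) -> f = g.
Proof. exact: (@tens_ext k B (rightm M) V). Qed.

Lemma tensm_ind V (C : tensm M V -> Prop) :
    C 0 -> (forall a y z, C y -> C z -> C (a *: y + z)) ->
    (forall m v, C (pure m v)) ->
  forall z, C z.
Proof.
move=> C0 CD Cp z; apply/(vspanP (V := tensm M V) z C0 CD).
suff /lfunP/(_ z) : vpi (vspan C) = 0.
  by rewrite zero_lfunE => /eqP; rewrite -memv_ker lker_vpi.
apply: tensm_ext => m v; rewrite zero_lfunE; apply/eqP.
by rewrite -memv_ker lker_vpi; apply: mem_vspan.
Qed.

Lemma tensm_is_hom V (Z : lmod A) (f : 'Hom(tensm M V, Z)) :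
  (forall a m v, f (lact a (pure m v)) = lact a (f (pure m v))) -> is_hom f.
Proof.
move=> fP a z; pose La := linfun (lact a : Z -> Z).
have LaE z' : La z' = lact a z' by rewrite linfunE //; apply: lact_linear.
suff E : (f \o tens_l M V a)%VF = (La \o f)%VF.
  by move/lfunP/(_ z): E; rewrite [LHS]comp_lfunE [RHS]comp_lfunE LaE.
by apply: tensm_ext => m v; rewrite [LHS]comp_lfunE [RHS]comp_lfunE LaE; apply: fP.
Qed.

Lemma tensm_mapE V W (f : 'Hom(V, W)) m v :
  is_hom f -> tensm_map M f (pure m v) = pure m (f v).
Proof. by move=> hf; apply: tens_mapE => // a u w; rewrite linearP. Qed.

Lemma tensm_map_hom V W (f : 'Hom(V, W)) : is_hom f -> is_hom (tensm_map M f).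
Proof.
by move=> hf; apply: tensm_is_hom => a m v; rewrite lact_pure !tensm_mapE // lact_pure.
Qed.

Lemma tensm_map_comp U V W (g : 'Hom(V, W)) (f : 'Hom(U, V)) : is_hom g -> is_hom f ->
  tensm_map M (g \o f)%VF = (tensm_map M g \o tensm_map M f)%VF.
Proof.
move=> hg hf; apply: tensm_ext => m v.
by rewrite [RHS]comp_lfunE !tensm_mapE ?comp_lfunE //; apply: comp_hom.
Qed.

Lemma tensm_map_id V : tensm_map M (\1%VF : 'Hom(V, V)) = \1%VF.
Proof.
by apply: tensm_ext => m v; rewrite tensm_mapE ?id_lfunE //; apply: id_is_hom.
Qed.

Lemma tensm_map_linear V W a (f g : 'Hom(V, W)) : is_hom f -> is_hom g ->
  tensm_map M (a *: f + g) = a *: tensm_map M f + tensm_map M g.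
Proof.
move=> hf hg; apply: tensm_ext => m v; rewrite add_lfunE scale_lfunE !tensm_mapE //.
  by rewrite add_lfunE scale_lfunE (pure_bilin W).1.
exact: linear_hom.
Qed.

Definition tensm_fun V (f : 'Hom(M, A)) (g : 'Hom(V, regmod B)) :
    'Hom(tensm M V, regmod A) :=
  @tlift k B (rightm M) V A (fun m v => f (br (g v : B) m)).

Lemma tensm_funE V (f : 'Hom(M, A)) (g : 'Hom(V, regmod B)) m v : is_hom g ->
  tensm_fun f g (pure m v) = f (br (g v : B) m).
Proof.
move=> hg; apply: tliftE => [|x b y].
  split=> [x|y] a u w; last by rewrite (act_linear (brP M)) linearP.
  by rewrite linearP (act_linearl (brP M)) linearP.
by rewrite hg; congr (f _); symmetry; apply: (actM (brP M)).
Qed.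

Lemma tensm_fun_hom V (f : 'Hom(M, A)) (g : 'Hom(V, regmod B)) :
  @is_hom k A (leftm M) (regmod A) f -> is_hom g -> is_hom (tensm_fun f g).
Proof.
move=> hf hg; apply: tensm_is_hom => a m v.
by rewrite lact_pure !tensm_funE // -blr [LHS]hf.
Qed.

(** A right linear map [b : M -> B] contracts [M \otimes_B V] to
[B \otimes_B V = V].  Right dual bases and the transfer are both made of
contractions. *)
Definition contract (b : 'Hom(M, B)) V : 'Hom(tensm M V, V) :=
  @tlift k B (rightm M) V V (fun m v => lact (b m) v).

Lemma contractE (b : 'Hom(M, B)) V m (v : V) :
    @is_hom k B^c (rightm M) (rightm (regbim B)) b ->
  contract b V (pure m v) = lact (b m) v.
Proof.
move=> hb; apply: tliftE => [|x c y].
  split=> [x|y] a u w; first exact: lact_linear.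
  by rewrite linearP (act_linearl (lactP V)).
by rewrite -lactA; congr (lact _ y); apply: hb.
Qed.

Lemma contract_natural (b : 'Hom(M, B)) V W (f : 'Hom(V, W)) z :
    @is_hom k B^c (rightm M) (rightm (regbim B)) b -> is_hom f ->
  contract b W (tensm_map M f z) = f (contract b V z).
Proof.
move=> hb hf; suff E : (contract b W \o tensm_map M f = f \o contract b V)%VF.
  by move/lfunP/(_ z): E; rewrite [LHS]comp_lfunE [RHS]comp_lfunE.
apply: tensm_ext => m v; rewrite [LHS]comp_lfunE [RHS]comp_lfunE.
by rewrite tensm_mapE // !contractE // hf.
Qed.

Section LeftBasis.
Variables (I : finType) (alpha : I -> 'Hom(M, A)) (m_ : I -> M).
Hypothesis bM : @projective_basis k A (leftm M) I alpha m_.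

Lemma tensm_basis P (J : finType) (g : J -> 'Hom(P, regmod B)) p :
    projective_basis g p ->
  projective_basis (fun ij : I * J => tensm_fun (alpha ij.1) (g ij.2))
    (fun ij => pure (m_ ij.1) (p ij.2)).
Proof.
move=> [hg gp]; have [ha am] := bM; split=> [ij|z]; first exact: tensm_fun_hom.
pose S : 'Hom(tensm M P, tensm M P) :=
  \sum_(ij : I * J) lambda (tensm_fun (alpha ij.1) (g ij.2)) (pure (m_ ij.1) (p ij.2)).
suff E : S = \1%VF.
  rewrite -[RHS]id_lfunE -E sum_lfunE; apply: eq_bigr => ij _.
  by rewrite lambdaE.
apply: tensm_ext => m x; rewrite id_lfunE sum_lfunE.
rewrite -(pair_bigA _ (fun i j => lambda (tensm_fun (alpha i) (g j))
  (pure (m_ i) (p j)) (pure m x))) exchange_big.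
rewrite -[in RHS](gp x) pure_sumr; apply: eq_bigr => j _.
rewrite -pure_balanced -[in RHS](am (br (g j x : B) m)) pure_suml.
apply: eq_bigr => i _; etransitivity; first exact: lambdaE.
by rewrite tensm_funE // lact_pure.
Qed.

Lemma tensm_has_basis P : has_basis P -> has_basis (tensm M P).
Proof.
by move=> [J [g [p bP]]]; eexists; eexists; eexists; apply: (tensm_basis bP).
Qed.

(** If [f] factors through [B], then [M \otimes f] factors through
[M \otimes B], which has a basis because [M] has one on the left. *)
Lemma tensm_prhom V W (f : 'Hom(V, W)) :
  f \in prhom V W -> tensm_map M f \in prhom (tensm M V) (tensm M W).
Proof.
move=> pf; suff H : is_hom f /\ tensm_map M f \in prhom (tensm M V) (tensm M W).
  by case: H.
move: f pf; apply: prhom_ind => [|a f g [hf Pf] [hg Pg]|al v ha].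
- have h0 : is_hom (0 : 'Hom(V, W)) by apply/mem_HomE/mem0v.
  split=> //; have -> : tensm_map M (0 : 'Hom(V, W)) = 0; last exact: mem0v.
  by apply: tensm_ext => m x; rewrite tensm_mapE // !zero_lfunE pure0r.
- by rewrite tensm_map_linear //; split; [exact: linear_hom|rewrite memvD ?memvZ].
split; first exact: lambda_hom.
have -> : lambda al v = (lambda \1%VF v \o al)%VF.
  by rewrite lambda_compr comp_lfun1l.
rewrite tensm_map_comp //; last exact/lambda_hom/id_is_hom.
apply: comp_prhom; [exact/tensm_has_basis/reg_has_basis|apply: tensm_map_hom..] => //.
exact/lambda_hom/id_is_hom.
Qed.

Definition tensst V W (x : sthom V W) : sthom (tensm M V) (tensm M W) :=
  scls (tensm_map M (srep x)).

Lemma tensst_scls V W (f : 'Hom(V, W)) :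
  is_hom f -> tensst (scls f) = scls (tensm_map M f).
Proof.
move=> hf; apply/scls_eq; [exact/tensm_map_hom/srep_hom|exact: tensm_map_hom|].
have := tensm_prhom (srep_scls hf); rewrite addrC -scaleN1r tensm_map_linear //.
  by rewrite scaleN1r addrC.
exact: srep_hom.
Qed.

Lemma tensst_linear V W : linear (@tensst V W).
Proof.
move=> a x y; have [f hf <-] := scls_surj x; have [g hg <-] := scls_surj y.
rewrite -scls_linear !tensst_scls //; last exact: linear_hom.
by rewrite tensm_map_linear // scls_linear.
Qed.

Lemma tensst_comp U V W (y : sthom V W) (x : sthom U V) :
  tensst (scomp y x) = scomp (tensst y) (tensst x).
Proof.
have [f hf <-] := scls_surj x; have [g hg <-] := scls_surj y.
rewrite scomp_scls // !tensst_scls //; last exact: comp_hom.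
by rewrite tensm_map_comp // scomp_scls //; apply: tensm_map_hom.
Qed.

Lemma tensst_id V : tensst (sid V) = sid (tensm M V).
Proof. by rewrite tensst_scls ?tensm_map_id //; apply: id_is_hom. Qed.

Lemma tensst_stmap X Y X' Y' (s : seq3 X Y) (s' : seq3 X' Y') x y :
    exact3 s -> exact3 s' -> stmap s s' x y ->
  stmap (tensm_seq M s) (tensm_seq M s') (tensst x) (tensst y).
Proof.
move=> xs xs' [f [g [[hf hg [h [hh hi hp]]] <- <-]]].
exists (tensm_map M f), (tensm_map M g); rewrite !tensst_scls //; split=> //.
split; [exact: tensm_map_hom|exact: tensm_map_hom|exists (tensm_map M h)].
have [[hi1 hi2] [hp1 hp2]] :=
  ((ex_inc_hom xs, ex_inc_hom xs'), (ex_pro_hom xs, ex_pro_hom xs')).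
split; first exact: tensm_map_hom.
  by rewrite -!tensm_map_comp // hi.
by rewrite -!tensm_map_comp // hp.
Qed.

(** A right dual basis writes an element of [M \otimes X] through its
contractions in [X]; since these commute with [M \otimes f], the functor is
exact. *)
Lemma tensm_exact X Y (s : seq3 X Y) :
  projective (rightm M) -> exact3 s -> exact3 (tensm_seq M s).
Proof.
move=> /projective_has_basis [J [de [n [hde dn]]]] [hi hp i0 sp mid bs].
have expand V z : z = \sum_j pure (n j) (contract (de j) V z).
  pose S : 'Hom(tensm M V, tensm M V) :=
    \sum_j (linfun (pure (n j) : V -> tensm M V) \o contract (de j) V)%VF.
  suff E : S = \1%VF.
    rewrite -[LHS]id_lfunE -E sum_lfunE; apply: eq_bigr => j _.
    by rewrite comp_lfunE linfunE //; apply: (pure_bilin V).1.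
  apply: tensm_ext => m v; rewrite id_lfunE sum_lfunE -[in RHS](dn m) pure_suml.
  apply: eq_bigr => j _; rewrite comp_lfunE linfunE; last exact: (pure_bilin V).1.
  rewrite (contractE m v (hde j)); exact: esym (pure_balanced _ _ _).
split; [exact: tensm_map_hom|exact: tensm_map_hom| | | |exact: tensm_has_basis].
- apply/eqP; rewrite -subv0; apply/subvP=> z; rewrite memv_ker => /eqP z0.
  rewrite memv0 (expand _ z) big1 // => j _; rewrite -[RHS](pure0r _ (n j)); congr pure.
  have /eqP/lker0P inji := i0; apply: inji.
  by rewrite -(contract_natural _ (hde j)) // z0 !linear0.
- apply/eqP; rewrite eqEsubv subvf; apply/subvP=> z _; rewrite (expand _ z).
  apply: memv_suml => j _; set y := contract _ _ z.
  have: y \in limg (spro s) by rewrite sp memvf.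
  by case/memv_imgP=> x _ ->; rewrite -tensm_mapE // memv_img ?memvf.
apply/vspaceP=> z; apply/idP/idP; last first.
  case/memv_imgP=> {}z _ ->; rewrite memv_ker -comp_lfunE -tensm_map_comp //.
  suff -> : tensm_map M (spro s \o sinc s)%VF = 0 by rewrite zero_lfunE.
  apply: tensm_ext => m x; rewrite tensm_mapE; last exact: comp_hom.
  rewrite zero_lfunE -[RHS](pure0r _ m); congr pure; apply/eqP.
  by rewrite comp_lfunE -memv_ker mid memv_img ?memvf.
rewrite memv_ker => /eqP z0; rewrite (expand _ z); apply: memv_suml => j _.
have: contract (de j) (smid s) z \in lker (spro s).
  by rewrite memv_ker -(contract_natural _ (hde j)) // z0 linear0.
by rewrite mid => /memv_imgP[x _ ->]; rewrite -tensm_mapE // memv_img ?memvf.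
Qed.

End LeftBasis.

End TensorFunctor.

(** * The transfer map *)

Section Associator.
Variables (k : fieldType) (A B C : falgType k).
Variables (X : bimod C A) (M : bimod A B) (V : lmod B).

Lemma tens_assocE x m v :
  tens_assoc X M V (@tpure k B (rightm (tensb X M)) V
                      (@tpure k A (rightm X) (leftm M) x m) v)
  = pure (M := X) x (pure (M := M) m v).
Proof.
pose F v' := fun x' m' => pure (M := X) x' (pure (M := M) (V := V) m' v').
have [Hr Hl] := @pure_bilin k C A X (tensm M V).
have [Kr Kl] := @pure_bilin k A B M V.
have bF v' : bilin (F v') by split=> [y|y] c u w; rewrite /F ?Kl ?Hr ?Hl.
have balF v' : @balanced k A (rightm X) (leftm M) _ (F v').
  by move=> y a n; rewrite /F [LHS]pure_balanced lact_pure.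
pose G v' : 'Hom(tensb X M, tensm X (tensm M V)) :=
  @tlift k A (rightm X) (leftm M) _ (F v').
have GE v' x' m' : G v' (@tpure k A (rightm X) (leftm M) x' m') = F v' x' m'.
  exact: tliftE.
etransitivity; first apply: (@tliftE k B (rightm (tensb X M)) V _ (fun z v => G v z)).
- split=> [z|v'] c u w; last exact: linearP.
  suff E : G (c *: u + w) = c *: G u + G w by rewrite E add_lfunE scale_lfunE.
  apply: (@tens_ext k A (rightm X) (leftm M)) => x' m'.
  by rewrite add_lfunE scale_lfunE !GE /F Kr Hr.
- move=> z b v'; suff E : (G v' \o tens_r (rightm X) M b)%VF = G (lact b v').
    by move/lfunP/(_ z): E; rewrite [LHS]comp_lfunE.
  apply: (@tens_ext k A (rightm X) (leftm M)) => x' m'.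
  by rewrite [LHS]comp_lfunE tens_rE !GE /F pure_balanced.
exact: GE.
Qed.

Lemma tens_assocVE x m v :
  tens_assocV X M V (pure (M := X) x (pure (M := M) m v))
  = @tpure k B (rightm (tensb X M)) V (@tpure k A (rightm X) (leftm M) x m) v.
Proof.
pose F x' := fun m' v' => @tpure k B (rightm (tensb X M)) V
  (@tpure k A (rightm X) (leftm M) x' m') v'.
have [Hr Hl] := @tpure_bilin k B (rightm (tensb X M)) V.
have [Kr Kl] := @tpure_bilin k A (rightm X) (leftm M).
have bF x' : bilin (F x') by split=> [y|y] c u w; rewrite /F ?Kr ?Hr ?Hl.
have balF x' : @balanced k B (rightm M) V _ (F x').
  move=> y b v'; rewrite /F -[RHS](@tpure_balanced k B (rightm (tensb X M)) V).
  by congr tpure; symmetry; apply: tens_rE.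
pose G x' : 'Hom(tensm M V, tensm (tensb X M) V) := @tlift k B (rightm M) V _ (F x').
have GE x' m' v' : G x' (pure m' v') = F x' m' v' by exact: tliftE.
etransitivity; first apply: (@tliftE k A (rightm X) (tensm M V) _ (fun x z => G x z)).
- split=> [x'|z] c u w; first exact: linearP.
  suff E : G (c *: u + w) = c *: G u + G w by rewrite E add_lfunE scale_lfunE.
  apply: tensm_ext => m' v'.
  by rewrite add_lfunE scale_lfunE !GE /F Kl Hl.
- move=> x' a z; suff E : G (ract x' a) = (G x' \o tens_l M V a)%VF.
    by move/lfunP/(_ z): E; rewrite [RHS]comp_lfunE.
  apply: tensm_ext => m' v'; rewrite [RHS]comp_lfunE tens_lE !GE /F.
  by congr tpure; apply: (@tpure_balanced k A (rightm X) (leftm M)).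
exact: GE.
Qed.

End Associator.

Section TransferMap.
Variables (k : fieldType) (A B : falgType k) (M : bimod A B).
Variables (s : vdual A) (t : vdual B).
Hypotheses (fs : trace_form s) (ft : trace_form t).
Variables (d : nat) (alpha : 'I_d -> 'Hom(M, A)) (m_ : 'I_d -> M).
Hypothesis bM : @projective_basis k A (leftm M) 'I_d alpha m_.
Implicit Types (U V W X Y P : lmod B).

(** Right modules are treated as left modules over the converse algebra, for which
[t] is again a trace form. *)
Lemma trace_form_converse : @trace_form k B^c t.
Proof.
split=> [a b|a a0|mu]; first exact: (sformC ft b a).
  by apply: (sform_eq0 ft) => b; rewrite (sformC ft); apply: a0.
have [a aE] := sform_rep ft mu; exists a => b.
by rewrite aE; apply: (sformC ft).
Qed.

Local Notation beta := (@beta_of k A B M t).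

Let is_rhom (b : 'Hom(M, B)) := @is_hom k B^c (rightm M) (rightm (regbim B)) b.

Lemma beta_ofP (mu : vdual M) :
  is_rhom (beta mu) /\ (forall m, t (beta mu m) = mu m).
Proof.
have [F hF FE] := sform_lift trace_form_converse (X := rightm M) mu.
have E : exists b : 'Hom(M, B), is_rhom b /\ (t \o b)%VF = mu.
  by exists F; split=> //; apply/lfunP=> m; rewrite comp_lfunE FE.
have [h1 h2] : is_rhom (beta mu) /\ (t \o beta mu)%VF = mu.
  exact: (@xgetPex _ 0 (fun b => is_rhom b /\ (t \o b)%VF = mu)).
by split=> // m; rewrite -comp_lfunE h2.
Qed.

Lemma beta_of_hom mu : is_rhom (beta mu).
Proof. by case: (beta_ofP mu). Qed.

Lemma beta_ofE mu m : t (beta mu m) = mu m.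
Proof. by case: (beta_ofP mu). Qed.

Lemma rhom_inj (b b' : 'Hom(M, B)) : is_rhom b -> is_rhom b' ->
  (forall m, t (b m) = t (b' m)) -> b = b'.
Proof. exact: (sform_hom_inj trace_form_converse (X := rightm M)). Qed.

Lemma beta_of_linear : linear beta.
Proof.
move=> a mu nu; apply: rhom_inj => [||m]; first exact: beta_of_hom.
  exact: (@linear_hom _ B^c (rightm M) (rightm (regbim B)) a _ _
    (beta_of_hom mu) (beta_of_hom nu)).
by rewrite add_lfunE scale_lfunE linearP /= !beta_ofE add_lfunE scale_lfunE.
Qed.

Lemma beta_of_dual_r a (mu : vdual M) m : beta (dual_r a mu) m = beta mu (bl a m).
Proof.
have lin : linear (bl a : M -> M) by apply: (act_linear (blP M)).
suff -> : beta (dual_r a mu) = (beta mu \o linfun (bl a))%VF.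
  by rewrite comp_lfunE linfunE.
apply: rhom_inj => [||m']; first exact: beta_of_hom.
  move=> b m'; rewrite !comp_lfunE !linfunE // [bl a _]blr.
  exact: (beta_of_hom mu).
by rewrite beta_ofE dual_rE comp_lfunE linfunE // beta_ofE.
Qed.

(** The right [B]-linear maps with [t \o tr_coef i = s \o alpha i]; they are the
coefficients of the transfer in [tr_repE]. *)
Definition tr_coef i : 'Hom(M, B) := beta (s \o alpha i)%VF.

Lemma tr_coefE i m : t (tr_coef i m) = s (alpha i m).
Proof. by rewrite beta_ofE comp_lfunE. Qed.

Lemma tr_coefM i m (b : B) : tr_coef i (br b m) = (tr_coef i m : B) * b.
Proof. exact: beta_of_hom. Qed.

Lemma tr_coef_form i m (b : B) : t ((tr_coef i m : B) * b) = s (alpha i (br b m)).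
Proof. by rewrite -tr_coefM; apply: tr_coefE. Qed.

Lemma alphaM i (a : A) m : alpha i (bl a m) = a * alpha i m.
Proof. exact: (proj1 bM i). Qed.

Lemma dual_basisE m : \sum_i bl (alpha i m) (m_ i) = m.
Proof. exact: (proj2 bM m). Qed.

(** The identity behind the centrality of the Casimir element
[\sum_i (s \o alpha i) \otimes m_i]: write [m] in the dual basis. *)
Lemma casimir_sum b j m : \sum_i s (alpha j (br b (m_ i)) * alpha i m) = s (alpha j (br b m)).
Proof.
rewrite -[in RHS](dual_basisE m).
have lb : linear (br b : M -> M) by apply: (act_linear (brP M)).
rewrite -[br b _](linfunE lb) !linear_sum; apply: eq_bigr => i _ /=.
by rewrite linfunE // -blr alphaM (sformC fs).
Qed.

(** Nondegeneracy of [t] reduces the identity to [casimir_sum]. *)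
Lemma casimir_coef b j m : \sum_i tr_coef i (bl (alpha j (br b (m_ i))) m) = b * tr_coef j m.
Proof.
apply: (sform_inj ft) => c; rewrite mulrA (sformC ft c) (sformC ft (c * b)).
have brM : br (c * b) m = br b (br c m) by apply: (actM (brP M)).
rewrite tr_coef_form brM -casimir_sum mulr_suml linear_sum.
by apply: eq_bigr => i _ /=; rewrite tr_coef_form -blr alphaM.
Qed.

Local Notation dM := (dualbim M).
Local Notation dpure := (@tpure k A (rightm dM) (leftm M)).

Lemma dpure_dual_r (mu : vdual M) a m : dpure (dual_r a mu) m = dpure mu (bl a m).
Proof. exact: (@tpure_balanced k A (rightm dM) (leftm M)). Qed.

Lemma dpure_sumr (mu : vdual M) I (r : seq I) (F : I -> M) :
  dpure mu (\sum_(i <- r) F i) = \sum_(i <- r) dpure mu (F i).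
Proof. exact: (@pure_sumr k B A dM (leftm M)). Qed.

Lemma dpure_suml I (r : seq I) (F : I -> vdual M) (m : M) :
  dpure (\sum_(i <- r) F i) m = \sum_(i <- r) dpure (F i) m.
Proof. exact: (@pure_suml k B A dM (leftm M)). Qed.

Definition casimir : MdM M := \sum_i dpure (s \o alpha i)%VF (m_ i).

Lemma casimir_central b : bl b casimir = br b casimir.
Proof.
have sumbl : bl b casimir = \sum_i dpure (dual_l b (s \o alpha i)%VF) (m_ i).
  etransitivity; first exact: (@lact_sumr k B (leftm (MdM M)) b _ _
    (fun i => dpure (s \o alpha i)%VF (m_ i))).
  apply: eq_bigr => i _.
  exact: (@tens_lE k B A dM (leftm M)).
have sumbr : br b casimir = \sum_i dpure (s \o alpha i)%VF (br b (m_ i)).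
  etransitivity; first exact: (@lact_sumr k B^c (rightm (MdM M)) b _ _
    (fun i => dpure (s \o alpha i)%VF (m_ i))).
  apply: eq_bigr => i _.
  exact: (@tens_rE k A B (rightm dM) M).
rewrite sumbl sumbr.
under [RHS]eq_bigr => i _ do rewrite -[br b (m_ i)]dual_basisE dpure_sumr.
rewrite exchange_big; apply: eq_bigr => j _ /=.
under eq_bigr => i _ do rewrite -dpure_dual_r.
rewrite -dpure_suml; congr (dpure _ _); apply/lfunP=> m.
rewrite dual_lE comp_lfunE -casimir_sum sum_lfunE; apply: eq_bigr => i _.
by rewrite dual_rE comp_lfunE alphaM.
Qed.

Lemma eps_trE b : eps_tr s alpha m_ b = bl b casimir.
Proof. by rewrite linfunE //; apply: (act_linearl (blP (MdM M))). Qed.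

Lemma eta_trE mu m : eta_tr M t (dpure mu m) = beta mu m.
Proof.
apply: (@tliftE k A (rightm dM) (leftm M) B).
  split=> [nu|n] a u v; first exact: linearP.
  by rewrite beta_of_linear add_lfunE scale_lfunE.
by move=> nu a n; apply: beta_of_dual_r.
Qed.

(** The last three maps in the definition of the transfer compose to a
contraction. *)
Lemma eta_contract X mu z :
  of_regtens X (@tens_map k B (rightm (MdM M)) (rightm (regbim B)) X X (eta_tr M t)
    (fun x => x) (tens_assocV dM M X (pure (M := dM) mu z))) = contract (beta mu) X z.
Proof.
set e := @tens_map _ _ _ _ _ _ _ _.
pose G : 'Hom(tensm M X, X) := (of_regtens X \o e \o tens_assocV dM M X \o
  linfun (pure (M := dM) mu : tensm M X -> tensm dM (tensm M X)))%VF.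
have lpure : linear (pure (M := dM) mu : tensm M X -> tensm dM (tensm M X)).
  exact: (@pure_bilin k B A dM (tensm M X)).1.
have GE z' : G z' = of_regtens X (e (tens_assocV dM M X (pure (M := dM) mu z'))).
  by rewrite /G; do 3 rewrite [LHS]comp_lfunE; rewrite linfunE.
rewrite -GE; suff -> : G = contract (beta mu) X by [].
apply: tensm_ext => m x; rewrite GE tens_assocVE contractE; last exact: beta_of_hom.
rewrite /e tens_mapE //; first last.
- move=> b y; suff E : (eta_tr M t \o tens_r (rightm dM) M b)%VF =
    (linfun (fun c : B => c * b) \o eta_tr M t)%VF.
    move/lfunP/(_ y): E; rewrite [LHS]comp_lfunE [RHS]comp_lfunE => ->.
    by rewrite linfunE // => c u v; rewrite mulrDl scalerAl.
  apply: tens_ext => mu' m'; rewrite [LHS]comp_lfunE [RHS]comp_lfunE tens_rE !eta_trE.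
  rewrite linfunE; last by move=> c u v; rewrite mulrDl scalerAl.
  exact: beta_of_hom.
- by move=> a u v; rewrite linearP.
rewrite eta_trE; apply: (@tliftE k B (rightm (regbim B)) X X (fun b x => lact (b : B) x)).
  by split=> [b|y] a u v; [apply: lact_linear|apply: (act_linearl (lactP X))].
by move=> c b y; apply: lactA.
Qed.

Local Notation trr V X := (@tr_rep k A B M s t d alpha m_ V X).

(** The composite that defines the transfer of [eta] inserts the Casimir element,
applies [eta] and contracts.  All further properties are read off this formula. *)
Lemma tr_repE V X (eta : 'Hom(tensm M V, tensm M X)) v : is_hom eta ->
  trr V X eta v = \sum_i contract (tr_coef i) X (eta (pure (m_ i) v)).
Proof.
move=> heta; rewrite /tr_rep; do 6 rewrite [LHS]comp_lfunE.
have -> : to_regtens V v = @tpure k B (rightm (regbim B)) V (1 : B) v.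
  by rewrite linfunE //; apply: (@tpure_bilin k B (rightm (regbim B)) V).1.
rewrite tens_mapE //; first last.
- move=> b c; rewrite !eps_trE [LHS](actM (blP (MdM M))).
  rewrite casimir_central; exact: (@blr k B B (MdM M)).
- by move=> a b c; rewrite linearP.
have -> : eps_tr s alpha m_ (1 : B) = casimir.
  by rewrite eps_trE (act1 (blP (MdM M))).
rewrite [X in tens_assoc _ _ _ X](@pure_suml k B B (MdM M) V) !linear_sum.
apply: eq_bigr => i _ /=; rewrite tens_assocE tensm_mapE // eta_contract //.
Qed.

Lemma contract_casimir b j X z :
  \sum_i contract (tr_coef i) X (lact (alpha j (br b (m_ i))) z)
  = lact b (contract (tr_coef j) X z).
Proof.
move: z; apply: tensm_ind => [|a y z Ey Ez|m x].
- by rewrite linear0 lact0 big1 // => i _; rewrite lact0 linear0.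
- rewrite linearP lact_linear -Ey -Ez scaler_sumr -big_split.
  by apply: eq_bigr => i _; rewrite lact_linear linearP.
rewrite contractE; last exact: beta_of_hom.
rewrite -lactA -casimir_coef lact_suml; apply: eq_bigr => i _.
by rewrite lact_pure contractE //; apply: beta_of_hom.
Qed.

Lemma tr_rep_hom V X (eta : 'Hom(tensm M V, tensm M X)) :
  is_hom eta -> is_hom (trr V X eta).
Proof.
move=> heta b v; rewrite !tr_repE // lact_sumr.
under eq_bigr => i _ do
  rewrite -pure_balanced -[br b (m_ i)]dual_basisE pure_suml !linear_sum.
rewrite exchange_big; apply: eq_bigr => j _ /=; rewrite -contract_casimir.
by apply: eq_bigr => i _; rewrite -lact_pure heta.
Qed.

Lemma tr_rep_natural U V X Y (f : 'Hom(X, Y)) (g : 'Hom(U, V))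
    (eta : 'Hom(tensm M V, tensm M X)) :
    is_hom f -> is_hom g -> is_hom eta ->
  trr U Y (tensm_map M f \o eta \o tensm_map M g)%VF = (f \o trr V X eta \o g)%VF.
Proof.
move=> hf hg heta; apply/lfunP=> u.
have [hMf hMg] := (tensm_map_hom (M := M) hf, tensm_map_hom (M := M) hg).
rewrite tr_repE; last by do 2!apply: comp_hom => //.
do 2 rewrite [RHS]comp_lfunE; rewrite tr_repE // linear_sum /=.
apply: eq_bigr => i _; do 2 rewrite [X in contract _ _ X]comp_lfunE.
by rewrite contract_natural ?tensm_mapE //; apply: beta_of_hom.
Qed.

Lemma tr_rep_naturall V X Y (f : 'Hom(X, Y)) (eta : 'Hom(tensm M V, tensm M X)) :
  is_hom f -> is_hom eta ->
  trr V Y (tensm_map M f \o eta)%VF = (f \o trr V X eta)%VF.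
Proof.
move=> hf heta; have := tr_rep_natural hf (@id_is_hom _ _ V) heta.
by rewrite tensm_map_id !comp_lfun1r.
Qed.

Lemma tr_rep_naturalr U V X (g : 'Hom(U, V)) (eta : 'Hom(tensm M V, tensm M X)) :
  is_hom g -> is_hom eta ->
  trr U X (eta \o tensm_map M g)%VF = (trr V X eta \o g)%VF.
Proof.
move=> hg heta; have := tr_rep_natural (@id_is_hom _ _ X) hg heta.
by rewrite tensm_map_id !comp_lfun1l.
Qed.

Lemma tr_rep_linear V X a (eta zeta : 'Hom(tensm M V, tensm M X)) :
    is_hom eta -> is_hom zeta ->
  trr V X (a *: eta + zeta) = a *: trr V X eta + trr V X zeta.
Proof.
move=> he hz; apply/lfunP=> v; rewrite add_lfunE scale_lfunE !tr_repE //;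
  last exact: linear_hom.
rewrite scaler_sumr -big_split; apply: eq_bigr => i _ /=.
by rewrite add_lfunE scale_lfunE linearP.
Qed.

(** A map factoring through [A] is a sum of maps [z |-> al z (m \otimes x)].  Such
a map factors through [M \otimes (b |-> b x)], so its transfer factors through
[B] by naturality. *)
Lemma tr_rep_prhom V X (eta : 'Hom(tensm M V, tensm M X)) :
  eta \in prhom (tensm M V) (tensm M X) -> trr V X eta \in prhom V X.
Proof.
have h0 : is_hom (0 : 'Hom(tensm M V, tensm M X)) by apply/mem_HomE/mem0v.
have tr0 : trr V X 0 = 0.
  apply/lfunP=> v; rewrite tr_repE // zero_lfunE big1 // => i _.
  by rewrite zero_lfunE linear0.
move=> pe; suff : is_hom eta /\ trr V X eta \in prhom V X by case.
move: eta pe; apply: prhom_ind => [|a f g [hf Pf] [hg Pg]|al y ha].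
- by rewrite tr0 mem0v.
- by rewrite tr_rep_linear //; split; [apply: linear_hom|rewrite memvD ?memvZ].
split; first exact: lambda_hom.
move: y; apply: tensm_ind => [|a y z Py Pz|m x].
- have -> : lambda al (0 : tensm M X) = 0; last by rewrite tr0 mem0v.
  by apply/lfunP=> z; rewrite lambdaE lact0 zero_lfunE.
- have -> : lambda al (a *: y + z) = a *: lambda al y + lambda al z.
    by apply/lfunP=> u; rewrite add_lfunE scale_lfunE !lambdaE lact_linear.
  by rewrite tr_rep_linear ?memvD ?memvZ //; apply: lambda_hom.
pose q : 'Hom(regmod B, X) := lambda \1%VF x.
have hq : is_hom q by apply/lambda_hom/id_is_hom.
have -> : lambda al (pure m x) = (tensm_map M q \o lambda al (pure m (1 : regmod B)))%VF.
  rewrite lambda_compl; last exact: tensm_map_hom.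
  by rewrite tensm_mapE // /q lambdaE id_lfunE (act1 (lactP X)).
rewrite tr_rep_naturall //; last exact: lambda_hom.
by apply: comp_prhom => //; [exact: reg_has_basis|exact/tr_rep_hom/lambda_hom].
Qed.

(** In the dual bases of [P] and of [M \otimes P], both traces are
[\sum_(i, j) t (g j (contract (tr_coef i) (eta (m_i \otimes p_j))))], because
[s (alpha i (m b)) = t (tr_coef i m * b)]. *)
Lemma ptr_tr_rep P (eta : 'Hom(tensm M P, tensm M P)) :
  has_basis P -> is_hom eta -> ptr t (trr P P eta) = ptr s eta.
Proof.
move=> [J [g [p bP]]] heta.
rewrite (ptr_basis ft bP); last exact: tr_rep_hom.
rewrite (ptr_basis fs (tensm_basis bM bP)) //.
rewrite -(pair_bigA _ (fun i j => s (tensm_fun (alpha i) (g j) (eta (pure (m_ i) (p j)))))).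
rewrite exchange_big; apply: eq_bigr => j _; rewrite tr_repE // !linear_sum.
apply: eq_bigr => i _ /=.
suff E : (t \o (g j \o contract (tr_coef i) P))%VF = (s \o tensm_fun (alpha i) (g j))%VF.
  move/lfunP/(_ (eta (pure (m_ i) (p j)))): E.
  by rewrite [LHS]comp_lfunE [RHS]comp_lfunE [X in t X]comp_lfunE.
apply: tensm_ext => m x; rewrite [LHS]comp_lfunE [RHS]comp_lfunE [X in t X]comp_lfunE.
have hg := proj1 bP; rewrite tensm_funE // contractE; last exact: beta_of_hom.
by rewrite (hg j) -tr_coef_form.
Qed.

Definition trst V X (z : sthom (tensm M V) (tensm M X)) : sthom V X :=
  scls (trr V X (srep z)).

Lemma trst_scls V X (eta : 'Hom(tensm M V, tensm M X)) :
  is_hom eta -> trst (scls eta) = scls (trr V X eta).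
Proof.
move=> he; apply/scls_eq; [exact/tr_rep_hom/srep_hom|exact: tr_rep_hom|].
have := tr_rep_prhom (srep_scls he); rewrite addrC -scaleN1r tr_rep_linear //.
  by rewrite scaleN1r addrC.
exact: srep_hom.
Qed.

Lemma trst_linear V X : linear (@trst V X).
Proof.
move=> a x y; have [f hf <-] := scls_surj x; have [g hg <-] := scls_surj y.
rewrite -scls_linear !trst_scls //; last exact: linear_hom.
by rewrite tr_rep_linear // scls_linear.
Qed.

Local Notation tst := (@tensst k A B M _ _).

Lemma trst_naturall V X Y (a : sthom X Y) (z : sthom (tensm M V) (tensm M X)) :
  trst (scomp (tst a) z) = scomp a (trst z).
Proof.
have [f hf <-] := scls_surj a; have [g hg <-] := scls_surj z.
rewrite (tensst_scls bM) // trst_scls // !scomp_scls //; try exact: tensm_map_hom.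
- rewrite trst_scls ?tr_rep_naturall //.
  by apply: comp_hom => //; apply: tensm_map_hom.
exact: tr_rep_hom.
Qed.

(** Naturality of [tr_rep] lets the same middle map, transferred, serve for the
original sequences. *)
Lemma trst_stmap X Y X' Y' (S : seq3 X Y) (S' : seq3 X' Y') x y :
    exact3 S -> exact3 S' -> stmap (tensm_seq M S) (tensm_seq M S') x y ->
  stmap S S' (trst x) (trst y).
Proof.
move=> xs xs' [f [g [[hf hg [h [hh hi hp]]] <- <-]]].
have [[hi1 hi2] [hp1 hp2]] :=
  ((ex_inc_hom xs, ex_inc_hom xs'), (ex_pro_hom xs, ex_pro_hom xs')).
exists (trr _ _ f), (trr _ _ g); rewrite !trst_scls //; split=> //.
split; [exact: tr_rep_hom|exact: tr_rep_hom|exists (trr _ _ h)].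
split; first exact: tr_rep_hom.
  by rewrite -tr_rep_naturalr // -tr_rep_naturall // -hi.
by rewrite -tr_rep_naturalr // -tr_rep_naturall // -hp.
Qed.

Hypothesis projM : projective (rightm M).

(** Apply [ptr_tr_rep] to the middle term of [S] and use naturality of the
transfer to pull the maps of [S] out of it. *)
Lemma pairing_trr X Y (S : seq3 X Y) V (x : sthom V X) (z : sthom (tensm M Y) (tensm M V)) :
  exact3 S -> pairing s (tensm_seq M S) (tst x) z = pairing t S x (trst z).
Proof.
move=> xS; have [f hf <-] := scls_surj x; have [g hg <-] := scls_surj z.
have [[hi hp] bS] := (ex_inc_hom xS, ex_pro_hom xS, ex_basis xS).
rewrite (tensst_scls bM) // trst_scls // !pairing_scls //;
  try solve [exact: (tensm_exact bM) | exact: tensm_map_hom | exact: tr_rep_hom].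
rewrite -tensm_map_comp // -ptr_tr_rep //.
  by rewrite tr_rep_natural //; apply: comp_hom.
apply: comp_hom; last exact: tensm_map_hom.
by apply: comp_hom => //; apply/tensm_map_hom/comp_hom.
Qed.

Lemma pairing_trl X Y (S : seq3 X Y) V (y : sthom Y V) (z : sthom (tensm M V) (tensm M X)) :
  exact3 S -> pairing s (tensm_seq M S) z (tst y) = pairing t S (trst z) y.
Proof.
move=> xS; have [f hf <-] := scls_surj y; have [g hg <-] := scls_surj z.
have [[hi hp] bS] := (ex_inc_hom xS, ex_pro_hom xS, ex_basis xS).
rewrite (tensst_scls bM) // trst_scls // !pairing_scls //;
  try solve [exact: (tensm_exact bM) | exact: tensm_map_hom | exact: tr_rep_hom].
rewrite -comp_lfunA -tensm_map_comp // -ptr_tr_rep //.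
  by rewrite tr_rep_natural ?comp_lfunA //; apply: comp_hom.
apply: comp_hom; last exact/tensm_map_hom/comp_hom.
by apply: comp_hom => //; apply: tensm_map_hom.
Qed.

End TransferMap.

(** * Iterated shifts and their comparison under a functor *)

Section Casts.
Variables (k : fieldType) (E : falgType k).

Lemma scast_irr (U V : lmod E) (e e' : U = V) : scast e = scast e'.
Proof. by rewrite (Prop_irrelevance e e'). Qed.

Lemma scast_id (U : lmod E) (e : U = U) : scast e = sid U.
Proof. by rewrite (scast_irr e erefl). Qed.

End Casts.

Section Iterates.
Variables (k : fieldType) (E : falgType k) (S : lmod E -> lmod E).
Variable Sm : forall U V, sthom U V -> sthom (S U) (S V).
Hypothesis Sm_id : forall U, Sm (sid U) = sid (S U).
Hypothesis Sm_comp : forall U V W (y : sthom V W) (x : sthom U V),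
  Sm (scomp y x) = scomp (Sm y) (Sm x).

Fixpoint mapn m U V : sthom U V -> sthom (iter m S U) (iter m S V) :=
  match m with
  | 0%N => fun x => x
  | m'.+1 => fun x => Sm (mapn m' x)
  end.

Lemma mapn_id m U : mapn m (sid U) = sid (iter m S U).
Proof. by elim: m => //= m ->; apply: Sm_id. Qed.

Lemma mapn_comp m U V W (y : sthom V W) (x : sthom U V) :
  mapn m (scomp y x) = scomp (mapn m y) (mapn m x).
Proof. by elim: m => //= m ->; apply: Sm_comp. Qed.

Lemma mapn_scast m U V (e : U = V) : scast (congr1 (iter m S) e) = mapn m (scast e).
Proof. by case: V / e; rewrite mapn_id. Qed.

Lemma Sm_scast U V (e : U = V) : scast (congr1 S e) = Sm (scast e).
Proof. by case: V / e; rewrite Sm_id. Qed.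

Lemma scast_iterSr m U :
  scast (iterSr m.+1 S U) = Sm (scast (iterSr m S U)).
Proof. by rewrite -Sm_scast; apply: scast_irr. Qed.

(** The two parenthesisations of the iterate, [S^m (S U)] and [S (S^m U)], are
equal but not convertible; the cast between them is natural. *)
Lemma mapnSr m U V (f : sthom U V) :
  scomp (scast (iterSr m S V)) (mapn m.+1 f)
  = scomp (mapn m (Sm f)) (scast (iterSr m S U)).
Proof.
elim: m => [|m IHm]; first by rewrite !scast_id scomp1l scomp1r.
by rewrite !scast_iterSr -[mapn m.+2 f]/(Sm (mapn m.+1 f)) -Sm_comp IHm Sm_comp.
Qed.

Lemma siso_mapn m U V (x : sthom U V) : siso x -> siso (mapn m x).
Proof.
by move=> [y [yx xy]]; exists (mapn m y); rewrite -!mapn_comp yx xy !mapn_id.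
Qed.

End Iterates.

Section Cancel.
Variables (k : fieldType) (E : falgType k) (S O : lmod E -> lmod E).
Variable Sm : forall U V, sthom U V -> sthom (S U) (S V).
Variable Om : forall U V, sthom U V -> sthom (O U) (O V).
Hypothesis Sm_id : forall U, Sm (sid U) = sid (S U).
Hypothesis Sm_comp : forall U V W (y : sthom V W) (x : sthom U V),
  Sm (scomp y x) = scomp (Sm y) (Sm x).
Hypothesis Om_id : forall U, Om (sid U) = sid (O U).
Hypothesis Om_comp : forall U V W (y : sthom V W) (x : sthom U V),
  Om (scomp y x) = scomp (Om y) (Om x).
Variable e : forall U, sthom (S (O U)) U.
Hypothesis e_natural : forall U V (f : sthom U V),
  scomp (e V) (Sm (Om f)) = scomp f (e U).

Fixpoint canceln m V : sthom (iter m S (iter m O V)) V :=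
  match m with
  | 0%N => sid V
  | m'.+1 =>
    scomp (e V)
      (scomp (Sm (canceln m' (O V)))
        (scast (congr1 (iter m'.+1 S) (iterSr m' O V))))
  end.

Lemma cancelnS m V : canceln m.+1 V =
  scomp (e V) (Sm (scomp (canceln m (O V)) (mapn Sm m (scast (iterSr m O V))))).
Proof. by rewrite Sm_comp; congr (scomp _ (scomp _ _)); apply: (mapn_scast Sm_id m.+1). Qed.

Lemma canceln_natural m U V (f : sthom U V) :
  scomp (canceln m V) (mapn Sm m (mapn Om m f)) = scomp f (canceln m U).
Proof.
elim: m U V f => [|m IHm] U V f; first by rewrite scomp1l scomp1r.
rewrite !cancelnS -[mapn Sm m.+1 _]/(Sm (mapn Sm m (mapn Om m.+1 f))).
rewrite -scompA -Sm_comp -scompA -mapn_comp // mapnSr // mapn_comp //.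
by rewrite [scomp (canceln m _) _]scompA IHm -scompA Sm_comp scompA e_natural scompA.
Qed.

End Cancel.

Section Comparison.
Variables (k : fieldType) (A B : falgType k).
Variable T : lmod B -> lmod A.
Variable Tm : forall U V, sthom U V -> sthom (T U) (T V).
Hypothesis Tm_id : forall U, Tm (sid U) = sid (T U).
Hypothesis Tm_comp : forall U V W (y : sthom V W) (x : sthom U V),
  Tm (scomp y x) = scomp (Tm y) (Tm x).

Section OneShift.
Variables (SA : lmod A -> lmod A) (SB : lmod B -> lmod B).
Variable SAm : forall U V, sthom U V -> sthom (SA U) (SA V).
Variable SBm : forall U V, sthom U V -> sthom (SB U) (SB V).
Hypothesis SAm_id : forall U, SAm (sid U) = sid (SA U).
Hypothesis SAm_comp : forall U V W (y : sthom V W) (x : sthom U V),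
  SAm (scomp y x) = scomp (SAm y) (SAm x).
Hypothesis SBm_id : forall U, SBm (sid U) = sid (SB U).
Variable th : forall W, sthom (SA (T W)) (T (SB W)).
Hypothesis th_natural : forall U V (f : sthom U V),
  scomp (Tm (SBm f)) (th U) = scomp (th V) (SAm (Tm f)).

Fixpoint compn m W : sthom (iter m SA (T W)) (T (iter m SB W)) :=
  match m with
  | 0%N => sid (T W)
  | m'.+1 => scomp (th (iter m' SB W)) (SAm (compn m' W))
  end.

Lemma compn_natural m U V (f : sthom U V) :
  scomp (Tm (mapn SBm m f)) (compn m U) = scomp (compn m V) (mapn SAm m (Tm f)).
Proof.
elim: m => [|m IHm] /=; first by rewrite scomp1l scomp1r.
by rewrite scompA th_natural -scompA -SAm_comp IHm SAm_comp scompA.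
Qed.

Lemma siso_compn m W : (forall W, siso (th W)) -> siso (compn m W).
Proof.
move=> iso_th; elim: m => [|m IHm] /=; first exact: siso_id.
by apply: siso_comp => //; apply: (@siso_mapn _ _ _ _ _ _ 1).
Qed.

Lemma compnSr m V :
  scomp (Tm (scast (iterSr m SB V))) (compn m.+1 V)
  = scomp (scomp (compn m (SB V)) (mapn SAm m (th V))) (scast (iterSr m SA (T V))).
Proof.
elim: m => [|m IHm].
  by rewrite /= !scast_id Tm_id SAm_id !scomp1l !scomp1r.
rewrite (scast_iterSr SBm_id) (scast_iterSr SAm_id).
transitivity (scomp (th (iter m SB (SB V)))
    (SAm (scomp (Tm (scast (iterSr m SB V))) (compn m.+1 V)))).
  by rewrite SAm_comp !scompA -th_natural.
by rewrite IHm !SAm_comp !scompA.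
Qed.

Section Transport.
Variable Tr : forall U V, sthom (T U) (T V) -> sthom U V.
Hypothesis iso_th : forall W, siso (th W).
Hypothesis Tr_th : forall U V (z : sthom (T U) (T V)) w,
  scomp w (th U) = scomp (th V) (SAm z) -> Tr w = SBm (Tr z).

(** Conjugating by the comparison maps, [Tr] commutes with every iterate of a shift
if it commutes with one: peel off the outermost shift, and cancel the invertible
comparison map of the remaining ones. *)
Lemma transport_compn m U V (z : sthom (T U) (T V)) w :
  scomp w (compn m U) = scomp (compn m V) (mapn SAm m z) ->
  Tr w = mapn SBm m (Tr z).
Proof.
elim: m w => [|m IHm] w; first by rewrite /= scomp1l scomp1r => ->.
have [c' [c'c cc']] := siso_compn m U iso_th.
pose w' := scomp (scomp (compn m V) (mapn SAm m z)) c'.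
have w'c : scomp w' (compn m U) = scomp (compn m V) (mapn SAm m z).
  by rewrite -scompA c'c scomp1r.
move=> /= wE; rewrite -(IHm _ w'c); apply: Tr_th.
have: scomp (scomp w (th (iter m SB U))) (SAm (compn m U)) =
      scomp (scomp (th (iter m SB V)) (SAm w')) (SAm (compn m U)).
  by rewrite -!scompA -SAm_comp w'c SAm_comp wE -!scompA.
move/(congr1 (fun f => scomp f (SAm c'))).
by rewrite -!scompA -!SAm_comp !cc' !SAm_id !scomp1r.
Qed.

End Transport.

End OneShift.

Variables (SA OA : lmod A -> lmod A) (SB OB : lmod B -> lmod B).
Variable SAm : forall U V, sthom U V -> sthom (SA U) (SA V).
Variable OAm : forall U V, sthom U V -> sthom (OA U) (OA V).
Variable SBm : forall U V, sthom U V -> sthom (SB U) (SB V).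
Variable OBm : forall U V, sthom U V -> sthom (OB U) (OB V).
Hypothesis SAm_id : forall U, SAm (sid U) = sid (SA U).
Hypothesis SAm_comp : forall U V W (y : sthom V W) (x : sthom U V),
  SAm (scomp y x) = scomp (SAm y) (SAm x).
Hypothesis OAm_id : forall U, OAm (sid U) = sid (OA U).
Hypothesis OAm_comp : forall U V W (y : sthom V W) (x : sthom U V),
  OAm (scomp y x) = scomp (OAm y) (OAm x).
Hypothesis SBm_id : forall U, SBm (sid U) = sid (SB U).
Hypothesis SBm_comp : forall U V W (y : sthom V W) (x : sthom U V),
  SBm (scomp y x) = scomp (SBm y) (SBm x).
Hypothesis OBm_id : forall U, OBm (sid U) = sid (OB U).
Variable thS : forall W, sthom (SA (T W)) (T (SB W)).
Hypothesis thS_natural : forall U V (f : sthom U V),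
  scomp (Tm (SBm f)) (thS U) = scomp (thS V) (SAm (Tm f)).
Variable thO : forall W, sthom (OA (T W)) (T (OB W)).
Hypothesis thO_natural : forall U V (f : sthom U V),
  scomp (Tm (OBm f)) (thO U) = scomp (thO V) (OAm (Tm f)).
Variable eA : forall U, sthom (SA (OA U)) U.
Hypothesis eA_natural : forall U V (f : sthom U V),
  scomp (eA V) (SAm (OAm f)) = scomp f (eA U).
Variable eB : forall V, sthom (SB (OB V)) V.
Hypothesis eAB : forall V,
  scomp (Tm (eB V)) (scomp (thS (OB V)) (SAm (thO V))) = eA (T V).

(** The comparison isomorphisms of [S^m] and [O^m] are compatible with the
cancellations [S^m O^m -> 1].  The cancellation removes the innermost pair
first while [compn] is built from the outside; [compnSr] reconciles the two. *)
Lemma canceln_compn m V :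
  scomp (Tm (canceln SBm eB m V))
    (scomp (compn SAm thS m (iter m OB V)) (mapn SAm m (compn OAm thO m V)))
  = canceln SAm eA m (T V).
Proof.
elim: m V => [|m IHm] V; first by rewrite /= Tm_id !scomp1l.
set c := scast (iterSr m OB V); set cA := scast (iterSr m OA (T V)).
have K : scomp (Tm (scomp (canceln SBm eB m (OB V)) (mapn SBm m c)))
    (scomp (compn SAm thS m (iter m.+1 OB V)) (mapn SAm m (compn OAm thO m.+1 V)))
  = scomp (thO V) (scomp (canceln SAm eA m (OA (T V))) (mapn SAm m cA)).
  have natS := compn_natural SAm_comp thS_natural m c.
  have natO := compnSr OAm_id OAm_comp OBm_id thO_natural m V.
  rewrite Tm_comp -scompA [X in scomp _ X]scompA natS -[X in scomp _ X]scompA.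
  rewrite -(mapn_comp SAm_comp) natO !(mapn_comp SAm_comp) !scompA.
  rewrite -[X in scomp (scomp X _) _]scompA IHm.
  by rewrite (canceln_natural SAm_id SAm_comp OAm_id OAm_comp eA_natural).
rewrite (cancelnS SBm_id SBm_comp) (cancelnS SAm_id SAm_comp) Tm_comp.
transitivity (scomp (Tm (eB V)) (scomp (thS (OB V)) (SAm
  (scomp (Tm (scomp (canceln SBm eB m (OB V)) (mapn SBm m c)))
    (scomp (compn SAm thS m (iter m.+1 OB V)) (mapn SAm m (compn OAm thO m.+1 V))))))).
  by rewrite -scompA !SAm_comp !scompA -[X in scomp (scomp X _) _]scompA thS_natural !scompA.
by rewrite K SAm_comp !scompA -[scomp (scomp (Tm _) _) _]scompA eAB.
Qed.

End Comparison.

(** * The shifts of the stable category *)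

Section Shifts.
Variables (k : fieldType) (E : falgType k) (r : vdual E).
Hypothesis hr : trace_form r.
Variable R : resolution E.
Implicit Types (U V W : lmod E).

Local Notation om := (omega_exact R).
Local Notation si := (sigma_exact hr R).

Lemma Sigma_mapP U V (f : sthom U V) :
  stmap (sigma_seq R U) (sigma_seq R V) f (Sigma_map R f).
Proof. exact: (st_rightP hr (si U) (si V)). Qed.

Lemma Omega_mapP U V (f : sthom U V) :
  stmap (omega_seq R U) (omega_seq R V) (Omega_map R f) f.
Proof. exact: (st_leftP (om U) (om V)). Qed.

Lemma Sigma_map_id U : Sigma_map R (sid U) = sid (Sigma R U).
Proof. exact: (st_right_eq hr (si U) (si U) (stmap_id _)). Qed.

Lemma Omega_map_id U : Omega_map R (sid U) = sid (Omega R U).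
Proof. exact: (st_left_eq (om U) (om U) (stmap_id _)). Qed.

Lemma Sigma_map_comp U V W (y : sthom V W) (x : sthom U V) :
  Sigma_map R (scomp y x) = scomp (Sigma_map R y) (Sigma_map R x).
Proof.
apply: (st_right_eq hr (si U) (si W)).
exact: stmap_comp (Sigma_mapP x) (Sigma_mapP y).
Qed.

Lemma Omega_map_comp U V W (y : sthom V W) (x : sthom U V) :
  Omega_map R (scomp y x) = scomp (Omega_map R y) (Omega_map R x).
Proof.
apply: (st_left_eq (om U) (om W)).
exact: stmap_comp (Omega_mapP x) (Omega_mapP y).
Qed.

Lemma to_OmegaSigmaP U :
  stmap (sigma_seq R U) (omega_seq R (Sigma R U)) (to_OmegaSigma R U) (sid (Sigma R U)).
Proof. exact: (st_leftP (si U) (om (Sigma R U))). Qed.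

Lemma of_OmegaSigmaP U :
  stmap (omega_seq R (Sigma R U)) (sigma_seq R U) (of_OmegaSigma R U) (sid (Sigma R U)).
Proof. exact: (st_leftP (om (Sigma R U)) (si U)). Qed.

Lemma of_SigmaOmegaP U :
  stmap (sigma_seq R (Omega R U)) (omega_seq R U) (sid (Omega R U)) (of_SigmaOmega R U).
Proof. exact: (st_rightP hr (si (Omega R U)) (om U)). Qed.

Lemma of_SigmaOmega_natural U V (f : sthom U V) :
  scomp (of_SigmaOmega R V) (Sigma_map R (Omega_map R f)) = scomp f (of_SigmaOmega R U).
Proof.
apply: (stmap_uniqr hr (si (Omega R U)) (om V)).
  exact: stmap_comp (Sigma_mapP (Omega_map R f)) (of_SigmaOmegaP V).
by rewrite scomp1l -[Omega_map R f]scomp1r; apply: stmap_comp (Omega_mapP f);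
  apply: of_SigmaOmegaP.
Qed.

Lemma of_OmegaSigma_natural U V (f : sthom U V) :
  scomp (of_OmegaSigma R V) (Omega_map R (Sigma_map R f)) = scomp f (of_OmegaSigma R U).
Proof.
apply: (stmap_uniql (om (Sigma R U)) (si V)).
  exact: stmap_comp (Omega_mapP (Sigma_map R f)) (of_OmegaSigmaP V).
by rewrite scomp1l -[Sigma_map R f]scomp1r; apply: stmap_comp (Sigma_mapP f);
  apply: of_OmegaSigmaP.
Qed.

Lemma Sigma_map_linear U V : linear (@Sigma_map k E R U V).
Proof. exact: (st_right_linear hr (si U) (si V)). Qed.

Lemma Omega_map_linear U V : linear (@Omega_map k E R U V).
Proof. exact: (st_left_linear (om U) (om V)). Qed.

Lemma shift_map_linear n U V : linear (@shift_map k E R n U V).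
Proof.
case: n => m /=.
  elim: m => //= m IHm a x y; rewrite -Sigma_map_linear; congr (Sigma_map R _).
  exact: IHm.
suff H : forall a x y, @Omega_mapn k E R m U V (a *: x + y) =
    a *: Omega_mapn R m x + Omega_mapn R m y.
  by move=> a x y; rewrite H Omega_map_linear.
by elim: m => //= m IHm a x y; rewrite IHm Omega_map_linear.
Qed.

Lemma shift_map_comp n U V W (y : sthom V W) (x : sthom U V) :
  shift_map R n (scomp y x) = scomp (shift_map R n y) (shift_map R n x).
Proof.
case: n => m.
  exact: (@mapn_comp _ _ _ (@Sigma_map k E R) Sigma_map_comp m).
exact: (@mapn_comp _ _ _ (@Omega_map k E R) Omega_map_comp m.+1).
Qed.

Lemma tate0E U V (x : sthom V (Omega R U)) (y : sthom U V) :
  tate0 R r U V x y = pairing r (omega_seq R U) x y.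
Proof.
have hinc := ex_inc_hom (om U); have hpro := ex_pro_hom (om U).
have E0 (x' : sthom V (Omega R U)) (y' : sthom U V) :
    hat r (omega_inc R U \o srep x')%VF (mkhom (srep y' \o po_map (res_proj R U))%VF)
    = pairing r (omega_seq R U) x' y'.
  rewrite (hat_ptr hr (ex_basis (om U))).
  - by rewrite /pairing !comp_lfunA.
  - exact/comp_hom/srep_hom/hinc.
  exact/comp_hom/hpro/srep_hom.
have linR x' : linear (fun y' : sthom U V =>
    hat r (omega_inc R U \o srep x')%VF
      (mkhom (srep y' \o po_map (res_proj R U))%VF) : k^o).
  by move=> a u v; rewrite !E0; apply: (pairing_linearr hr _ _ _ _ (om U)).
rewrite /tate0 linfunE; first by rewrite linfunE.
move=> a u v; apply/lfunP=> z; rewrite add_lfunE scale_lfunE !linfunE // !E0.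
exact: (pairing_linearl hr _ _ _ _ (om U)).
Qed.

Lemma tateE n U V (x : Ext R (n - 1) V U) (y : Ext R (- n) U V) :
  tate R r n U V x y =
  pairing r (omega_seq R (shift R n U)) (scomp (shift_pred R n U) x)
    (scomp (shift_cancel R n V) (shift_map R n y)).
Proof.
rewrite /tate; do 2 rewrite comp_lfunE.
rewrite [X in tate0 _ _ _ _ X]linfunE; last exact: scomp_linearr.
rewrite /vdual_map linfunE; last first.
  by move=> a u v; rewrite comp_lfunDl -comp_lfunZl.
rewrite comp_lfunE [X in tate0 _ _ _ _ _ X]linfunE; first exact: tate0E.
by move=> a u v; rewrite shift_map_linear scomp_linearr.
Qed.

End Shifts.

(** * The shifts and the functor [M \otimes -] *)

Section TensorShifts.
Variables (k : fieldType) (A B : falgType k) (M : bimod A B).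
Variables (s : vdual A) (t : vdual B).
Hypotheses (fs : trace_form s) (ft : trace_form t).
Variables (d : nat) (alpha : 'I_d -> 'Hom(M, A)) (m_ : 'I_d -> M).
Hypothesis bM : @projective_basis k A (leftm M) 'I_d alpha m_.
Hypothesis projM : projective (rightm M).
Variables (RA : resolution A) (RB : resolution B).
Implicit Types (U V W X Y : lmod B).

Local Notation omA := (omega_exact RA).
Local Notation siA := (sigma_exact fs RA).
Local Notation omB := (omega_exact RB).
Local Notation siB := (sigma_exact ft RB).
Local Notation Mom V := (tensm_exact bM projM (omega_exact RB V)).
Local Notation Msi V := (tensm_exact bM projM (sigma_exact ft RB V)).
Local Notation tst := (@tensst k A B M _ _).
Local Notation T := (tensm M).
Let tst_id := tensst_id bM.
Let tst_comp := tensst_comp bM.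

Definition cmp_Sigma W : sthom (Sigma RA (T W)) (T (Sigma RB W)) :=
  st_right (sigma_seq RA (T W)) (tensm_seq M (sigma_seq RB W)) (sid (T W)).

Definition cmp_Omega W : sthom (Omega RA (T W)) (T (Omega RB W)) :=
  st_left (omega_seq RA (T W)) (tensm_seq M (omega_seq RB W)) (sid (T W)).

Lemma cmp_SigmaP W : stmap (sigma_seq RA (T W)) (tensm_seq M (sigma_seq RB W))
  (sid (T W)) (cmp_Sigma W).
Proof. exact: (st_rightP fs (siA _) (Msi _)). Qed.

Lemma cmp_OmegaP W : stmap (omega_seq RA (T W)) (tensm_seq M (omega_seq RB W))
  (cmp_Omega W) (sid (T W)).
Proof. exact: (st_leftP (omA _) (Mom _)). Qed.

Lemma cmp_Sigma_natural U V (f : sthom U V) :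
  scomp (tst (Sigma_map RB f)) (cmp_Sigma U) = scomp (cmp_Sigma V) (Sigma_map RA (tst f)).
Proof.
apply: (stmap_uniqr fs (siA _) (Msi _) (x := tst f)).
  rewrite -[tst f]scomp1r; apply: stmap_comp (cmp_SigmaP U) _.
  exact: (tensst_stmap bM (siB _) (siB _) (Sigma_mapP ft RB f)).
by rewrite -[X in stmap _ _ X]scomp1l; apply: stmap_comp (cmp_SigmaP V);
  apply: (Sigma_mapP fs).
Qed.

Lemma cmp_Omega_natural U V (f : sthom U V) :
  scomp (tst (Omega_map RB f)) (cmp_Omega U) = scomp (cmp_Omega V) (Omega_map RA (tst f)).
Proof.
apply: (stmap_uniql (omA _) (Mom _) (y := tst f)).
  rewrite -[tst f]scomp1r; apply: stmap_comp (cmp_OmegaP U) _.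
  exact: (tensst_stmap bM (omB _) (omB _) (Omega_mapP RB f)).
by rewrite -[X in stmap _ _ _ X]scomp1l; apply: stmap_comp (cmp_OmegaP V); apply: Omega_mapP.
Qed.

Lemma siso_cmp_Sigma W : siso (cmp_Sigma W).
Proof. exact: (siso_right fs (siA _) (Msi _) (cmp_SigmaP W) (siso_id _)). Qed.

Lemma siso_cmp_Omega W : siso (cmp_Omega W).
Proof. exact: (siso_left (omA _) (Mom _) (cmp_OmegaP W) (siso_id _)). Qed.

(** The steps in the recursive definition of the comparison maps, as composites of
a single comparison map and a shifted one. *)
Lemma st_right_cmp (U : lmod A) W (f : sthom U (T W)) :
  st_right (sigma_seq RA U) (tensm_seq M (sigma_seq RB W)) f
  = scomp (cmp_Sigma W) (Sigma_map RA f).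
Proof.
apply: (st_right_eq fs (siA _) (Msi _)); rewrite -[X in stmap _ _ X]scomp1l.
exact: stmap_comp (Sigma_mapP fs RA f) (cmp_SigmaP W).
Qed.

Lemma st_left_cmp (U : lmod A) W (f : sthom U (T W)) :
  st_left (omega_seq RA U) (tensm_seq M (omega_seq RB W)) f
  = scomp (cmp_Omega W) (Omega_map RA f).
Proof.
apply: (st_left_eq (omA _) (Mom _)); rewrite -[X in stmap _ _ _ X]scomp1l.
exact: stmap_comp (Omega_mapP RA f) (cmp_OmegaP W).
Qed.

Lemma tensm_SigmanE m W :
  tensm_Sigman RA RB M m W = compn (@Sigma_map k A RA) cmp_Sigma m W.
Proof. by elim: m => //= m <-; apply: st_right_cmp. Qed.

Lemma tensm_OmeganE m W :
  tensm_Omegan RA RB M m W = compn (@Omega_map k A RA) cmp_Omega m W.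
Proof. by elim: m => //= m <-; apply: st_left_cmp. Qed.

(** Both sides are the right half of the map of sequences over [cmp_Omega V] from
the sequence that defines [\Sigma \Omega (M \otimes V)] to the tensored sequence
that defines [\Omega V]. *)
Lemma of_SigmaOmega_cmp V :
  scomp (tst (of_SigmaOmega RB V))
    (scomp (cmp_Sigma (Omega RB V)) (Sigma_map RA (cmp_Omega V)))
  = of_SigmaOmega RA (T V).
Proof.
have L := stmap_comp (stmap_comp (Sigma_mapP fs RA (cmp_Omega V)) (cmp_SigmaP _))
  (tensst_stmap bM (siB _) (omB _) (of_SigmaOmegaP ft RB V)).
have R := stmap_comp (of_SigmaOmegaP fs RA (T V)) (cmp_OmegaP V).
rewrite tst_id !scomp1l in L; rewrite scomp1r scomp1l in R.
exact: (stmap_uniqr fs (siA _) (Mom _) L R).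
Qed.

Lemma of_OmegaSigma_cmp V :
  scomp (tst (of_OmegaSigma RB V))
    (scomp (cmp_Omega (Sigma RB V)) (Omega_map RA (cmp_Sigma V)))
  = of_OmegaSigma RA (T V).
Proof.
have L := stmap_comp (stmap_comp (Omega_mapP RA (cmp_Sigma V)) (cmp_OmegaP _))
  (tensst_stmap bM (omB _) (siB _) (of_OmegaSigmaP ft RB V)).
have R := stmap_comp (of_OmegaSigmaP fs RA (T V)) (cmp_SigmaP V).
rewrite tst_id !scomp1l in L; rewrite scomp1r scomp1l in R.
exact: (stmap_uniql (omA _) (Msi _) L R).
Qed.

Lemma siso_tensm_shift n W : siso (tensm_shift RA RB M n W).
Proof.
case: n => m.
  rewrite /tensm_shift tensm_SigmanE; apply: siso_compn; last exact: siso_cmp_Sigma.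
    exact: (Sigma_map_id fs).
  exact: (Sigma_map_comp fs).
rewrite /tensm_shift tensm_OmeganE; apply: siso_compn; last exact: siso_cmp_Omega.
  exact: Omega_map_id.
exact: Omega_map_comp.
Qed.

Lemma tensm_shift_natural n U V (f : sthom U V) :
  scomp (tst (shift_map RB n f)) (tensm_shift RA RB M n U)
  = scomp (tensm_shift RA RB M n V) (shift_map RA n (tst f)).
Proof.
case: n => m.
  rewrite /tensm_shift !tensm_SigmanE.
  exact: (compn_natural (Sigma_map_comp fs RA) cmp_Sigma_natural).
rewrite /tensm_shift !tensm_OmeganE.
exact: (compn_natural (Omega_map_comp RA) cmp_Omega_natural m.+1).
Qed.

(** For [n = 0] and [n < 0] both sides are the next comparison map for [\Omega].
For [n > 0] both are, up to a cast, the left half of a map of sequences over the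
comparison map of [\Sigma^n], from the sequence that defines
[\Sigma \Sigma^(n-1) (M \otimes W)] to the tensored sequence that defines
[\Omega \Sigma^n W]. *)
Lemma tensm_shift_pred n W :
  scomp (st_left (omega_seq RA (shift RA n (T W)))
    (tensm_seq M (omega_seq RB (shift RB n W))) (tensm_shift RA RB M n W))
    (shift_pred RA n (T W))
  = scomp (tst (shift_pred RB n W)) (tensm_shift RA RB M (n - 1) W).
Proof.
have castE i j (e : i = j) :
    scomp (tensm_shift RA RB M j W) (scast (congr1 (shift RA ^~ (T W)) e))
    = scomp (tst (scast (congr1 (shift RB ^~ W) e))) (tensm_shift RA RB M i W).
  by case: j / e; rewrite !scast_id scomp1r tst_id scomp1l.
case: n => [[|m]|m].
- by rewrite /= scomp1r tst_id scomp1l.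
- rewrite /shift_pred tst_comp -scompA.
  transitivity (scomp (tst (to_OmegaSigma RB (iter m (Sigma RB) W)))
    (scomp (tensm_shift RA RB M m W) (scast (congr1 (shift RA ^~ (T W)) (PoszSB1 m))))).
    rewrite !scompA; congr (scomp _ _).
    set W' := iter m (Sigma RB) W; set U := iter m (Sigma RA) (T W).
    have cmpS : stmap (sigma_seq RA U) (tensm_seq M (sigma_seq RB W'))
        (tensm_Sigman RA RB M m W) (tensm_Sigman RA RB M m.+1 W).
      exact: (st_rightP fs (siA _) (Msi _)).
    have cmpO := st_leftP (omA (Sigma RA U)) (Mom (Sigma RB W')) (tensm_Sigman RA RB M m.+1 W).
    have L := stmap_comp (to_OmegaSigmaP fs RA U) cmpO.
    have R := stmap_comp cmpS (tensst_stmap bM (siB _) (omB _) (to_OmegaSigmaP ft RB W')).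
    rewrite scomp1r in L; rewrite tst_id scomp1l in R.
    exact: (stmap_uniql (siA _) (Mom _) L R).
  by rewrite castE.
exact: (castE _ _ (NegzB1 m)).
Qed.

Lemma tensm_shift_cancel n V :
  scomp (tst (shift_cancel RB n V))
    (scomp (tensm_shift RA RB M n (shift RB (- n) V))
      (shift_map RA n (tensm_shift RA RB M (- n) V)))
  = shift_cancel RA n (T V).
Proof.
case: n => [[|m]|m].
- by rewrite /= tst_id !scomp1l.
- rewrite -[tensm_shift RA RB M m.+1 _]/(tensm_Sigman RA RB M m.+1 _) tensm_SigmanE.
  rewrite -[tensm_shift RA RB M _ V]/(tensm_Omegan RA RB M m.+1 V) tensm_OmeganE.
  exact: (canceln_compn tst_id tst_comp (Sigma_map_id fs RA)
    (Sigma_map_comp fs RA) (Omega_map_id RA) (Omega_map_comp RA)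
    (Sigma_map_id ft RB) (Sigma_map_comp ft RB) (Omega_map_id RB)
    cmp_Sigma_natural cmp_Omega_natural (of_SigmaOmega_natural fs RA)
    of_SigmaOmega_cmp m.+1 V).
rewrite -[tensm_shift RA RB M (Negz m) _]/(tensm_Omegan RA RB M m.+1 _) tensm_OmeganE.
rewrite -[tensm_shift RA RB M _ V]/(tensm_Sigman RA RB M m.+1 V) tensm_SigmanE.
exact: (canceln_compn tst_id tst_comp (Omega_map_id RA) (Omega_map_comp RA)
  (Sigma_map_id fs RA) (Sigma_map_comp fs RA)
  (Omega_map_id RB) (Omega_map_comp RB) (Sigma_map_id ft RB)
  cmp_Omega_natural cmp_Sigma_natural (of_OmegaSigma_natural fs RA)
  of_OmegaSigma_cmp m.+1 V).
Qed.

Local Notation trst' := (@trst k A B M s t d alpha m_ _ _).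

(** [w] is the map that [z] induces between the tensored sequences; transferring
the map of sequences gives the shift of the transfer of [z]. *)
Lemma trst_cmp_Sigma U V (z : sthom (T U) (T V)) w :
  scomp w (cmp_Sigma U) = scomp (cmp_Sigma V) (Sigma_map RA z) ->
  trst' w = Sigma_map RB (trst' z).
Proof.
move=> wE; have zw := st_rightP fs (Msi U) (Msi V) z.
have := stmap_comp (cmp_SigmaP U) zw; rewrite scomp1r.
have := stmap_comp (Sigma_mapP fs RA z) (cmp_SigmaP V); rewrite scomp1l -wE => L R.
have := stmap_uniqr fs (siA _) (Msi _) L R.
have [c [_ cc]] := siso_cmp_Sigma U.
move/(congr1 (fun f => scomp f c)); rewrite -!scompA cc !scomp1r => wz.
apply: (stmap_uniqr ft (siB U) (siB V)) (Sigma_mapP ft RB _).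
by rewrite wz; apply: (trst_stmap fs ft bM (siB U) (siB V) zw).
Qed.

Lemma trst_cmp_Omega U V (z : sthom (T U) (T V)) w :
  scomp w (cmp_Omega U) = scomp (cmp_Omega V) (Omega_map RA z) ->
  trst' w = Omega_map RB (trst' z).
Proof.
move=> wE; have zw := st_leftP (Mom U) (Mom V) z.
have := stmap_comp (cmp_OmegaP U) zw; rewrite scomp1r.
have := stmap_comp (Omega_mapP RA z) (cmp_OmegaP V); rewrite scomp1l -wE => L R.
have := stmap_uniql (omA _) (Mom _) L R.
have [c [_ cc]] := siso_cmp_Omega U.
move/(congr1 (fun f => scomp f c)); rewrite -!scompA cc !scomp1r => wz.
apply: (stmap_uniql (omB U) (omB V)) (Omega_mapP RB _).
by rewrite wz; apply: (trst_stmap fs ft bM (omB U) (omB V) zw).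
Qed.

Lemma trst_shift n U V (z : sthom (T U) (T V)) w :
  scomp w (tensm_shift RA RB M n U) = scomp (tensm_shift RA RB M n V) (shift_map RA n z) ->
  trst' w = shift_map RB n (trst' z).
Proof.
case: n w => m w; rewrite /tensm_shift ?tensm_SigmanE ?tensm_OmeganE => wE.
  exact: (transport_compn (Sigma_map_id fs RA) (Sigma_map_comp fs RA)
    siso_cmp_Sigma trst_cmp_Sigma wE).
exact: (transport_compn (Omega_map_id RA) (Omega_map_comp RA)
  siso_cmp_Omega trst_cmp_Omega (m := m.+1) wE).
Qed.

Lemma tensm_ExtE n V W (x : Ext RB n V W) :
  tensm_Ext RA RB M n V W x = scomp (sinv (tensm_shift RA RB M n W)) (tst x).
Proof.
rewrite /tensm_Ext linfunE // => a u v.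
by rewrite -scomp_linearr -(tensst_linear bM).
Qed.

Lemma trE n V W (x : Ext RA n (T V) (T W)) :
  tr RA RB s t alpha m_ n V W x = trst' (scomp (tensm_shift RA RB M n W) x).
Proof.
rewrite /tr linfunE // => a u v.
by rewrite scomp_linearr; apply: (trst_linear fs ft bM).
Qed.

(** Naturality of the pairing along [\Omega \Sigma^n (M \otimes W) ->
M \otimes \Omega \Sigma^n W], read with the comparison maps. *)
Lemma pairing_shift n V W (x : sthom (T V) (shift RA (n - 1) (T W)))
    (y : sthom (T (shift RB n W)) (T V)) :
  pairing s (omega_seq RA (shift RA n (T W))) (scomp (shift_pred RA n (T W)) x)
    (scomp y (tensm_shift RA RB M n W))
  = pairing s (tensm_seq M (omega_seq RB (shift RB n W)))
      (scomp (tst (shift_pred RB n W)) (scomp (tensm_shift RA RB M (n - 1) W) x)) y.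
Proof.
have P := st_leftP (omA (shift RA n (T W))) (Mom (shift RB n W)) (tensm_shift RA RB M n W).
rewrite -(pairing_natural fs _ _ (omA _) (Mom _) P).
by rewrite scompA tensm_shift_pred scompA.
Qed.

(** Both values are the pairing, over the tensored sequence that defines
[\Omega \Sigma^n W], of [M \otimes x] with the map [M \otimes \Sigma^n W ->
M \otimes V] given by [z] and the identifications of shifts: on the right because
transfer and tensor product are adjoint for the pairing, on the left by naturality
of the pairing. *)
Lemma tate_tensm_Ext n V W (x : Ext RB (n - 1) V W) (z : Ext RA (- n) (T W) (T V)) :
  tate RA s n (T W) (T V) (tensm_Ext RA RB M (n - 1) V W x) z
  = tate RB t n W V x (tr RA RB s t alpha m_ (- n) W V z).
Proof.
rewrite (tateE fs) (tateE ft) tensm_ExtE trE.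
set th := tensm_shift RA RB M n W.
have [thK Kth] := sinvK (siso_tensm_shift n W).
set z' := scomp (tensm_shift RA RB M (- n) V) z.
(* The shift of [z'], conjugated by the comparison isomorphisms. *)
pose w := scomp (scomp (tensm_shift RA RB M n (shift RB (- n) V))
  (shift_map RA n z')) (sinv th).
have wth : scomp w th =
    scomp (tensm_shift RA RB M n (shift RB (- n) V)) (shift_map RA n z').
  by rewrite -scompA thK scomp1r.
rewrite -(trst_shift wth) -(trst_naturall fs ft bM).
rewrite -(pairing_trr fs ft bM projM _ _ (omB _)) tst_comp.
rewrite -tensm_shift_cancel -!scompA -(shift_map_comp fs) -/z'.
rewrite -wth [scomp (tst _) (scomp w th)]scompA pairing_shift.
have [_ Kp] := sinvK (siso_tensm_shift (n - 1) W).
by rewrite [scomp (tensm_shift _ _ _ _ _) _]scompA Kp scomp1l.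
Qed.

(** As before, with the transfer on the other side of the pairing. *)
Lemma tate_tr n V W (x : Ext RA (n - 1) (T V) (T W)) (y : Ext RB (- n) W V) :
  tate RB t n W V (tr RA RB s t alpha m_ (n - 1) V W x) y
  = tate RA s n (T W) (T V) x (tensm_Ext RA RB M (- n) W V y).
Proof.
rewrite (tateE fs) (tateE ft) tensm_ExtE trE.
rewrite -(trst_naturall fs ft bM) -(pairing_trl fs ft bM projM _ _ (omB _)).
rewrite tst_comp -pairing_shift; congr (pairing s _ _ _).
rewrite -scompA tensm_shift_natural -tensm_shift_cancel -!scompA -(shift_map_comp fs).
have [_ Kp] := sinvK (siso_tensm_shift (- n) V).
by rewrite [scomp (tensm_shift _ _ _ (- n) _) _]scompA Kp scomp1l.
Qed.

End TensorShifts.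

Theorem theorem1p2 (k : fieldType) (A B : falgType k)
    (s : vdual A) (t : vdual B) (hs : symmetrising s) (ht : symmetrising t)
    (RA : resolution A) (RB : resolution B)
    (M : bimod A B) (hMl : projective (leftm M)) (hMr : projective (rightm M))
    (d : nat) (alpha : 'I_d -> 'Hom(M, A)) (m_ : 'I_d -> M)
    (halpha : forall i, @is_hom k A (leftm M) (regmod A) (alpha i))
    (hdual : forall m' : M, \sum_i bl (alpha i m') (m_ i) = m')
    (V W : lmod B) (n : int) :
  (tate RA s n (tensm M W) (tensm M V) \o tensm_Ext RA RB M (n - 1) V W)%VF
    = (vdual_map (tr RA RB s t alpha m_ (- n) W V) \o tate RB t n W V)%VF
  /\
  (tate RB t n W V \o tr RA RB s t alpha m_ (n - 1) V W)%VF
    = (vdual_map (tensm_Ext RA RB M (- n) W V)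
       \o tate RA s n (tensm M W) (tensm M V))%VF.
Proof.
have [fs ft] := (symmetrising_form hs, symmetrising_form ht).
have bM : @projective_basis k A (leftm M) 'I_d alpha m_ by split.
have dual_mapE (X Y : vectType k) (f : 'Hom(X, Y)) mu : vdual_map f mu = (mu \o f)%VF.
  by rewrite linfunE // => a u v; rewrite comp_lfunDl -comp_lfunZl.
split; apply/lfunP=> x; rewrite [LHS]comp_lfunE [RHS]comp_lfunE dual_mapE.
  apply/lfunP=> z; rewrite [RHS]comp_lfunE.
  exact: (tate_tensm_Ext fs ft bM hMr).
apply/lfunP=> y; rewrite [RHS]comp_lfunE.
exact: (tate_tr fs ft bM hMr).
Qed.
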